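(* The group $VP_4$ is an HNN-extension with base group $$G_4=\langle c_{11},a_{21},a_{12},c_{21},c_{12},a_{31},a_{22},a_{13},b_{31},b_{22},b_{13}\rangle\le VP_4,$$ associated subgroups $A$ and $B$, and stable letter $a_{11}$ (the isomorphism $A\to B$ being $x\mapsto a_{11}^{-1}xa_{11}$, which sends the listed generators of $A$ to the listed generators of $B$, in order). The group $G_4$ is defined, on the generators listed, by the following relations (here $\varepsilon=\pm1$, and $c_{31}=b_{31}a_{31}$, $c_{22}=b_{22}a_{22}$, $c_{13}=b_{13}a_{13}$): 1) conjugations by $c_{11}^{\varepsilon}$: $$a_{21}^{c_{11}^{\varepsilon}}=a_{21},\quad a_{12}^{c_{11}^{\varepsilon}}=a_{12}^{c_{12}^{\varepsilon}c_{21}^{-\varepsilon}},\quad c_{21}^{c_{11}^{\varepsilon}}=c_{21},\quad c_{12}^{c_{11}^{\varepsilon}}=c_{12}^{c_{21}^{-\varepsilon}},$$ $$a_{31}^{c_{11}^{\varepsilon}}=a_{31},\quad a_{22}^{c_{11}^{\varepsilon}}=a_{22},\quad a_{13}^{c_{11}^{\varepsilon}}=a_{13}^{c_{13}^{\varepsilon}c_{22}^{-\varepsilon}},\quad b_{31}^{c_{11}^{\varepsilon}}=b_{31},\quad b_{22}^{c_{11}^{\varepsilon}}=b_{22},\quad b_{13}^{c_{11}^{\varepsilon}}=b_{13}^{c_{13}^{\varepsilon}c_{22}^{-\varepsilon}};$$ 2) conjugations by $c_{21}^{\varepsilon}$: $$a_{31}^{c_{21}^{\varepsilon}}=a_{31},\quad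 a_{22}^{c_{21}^{\varepsilon}}=a_{22}^{c_{22}^{\varepsilon}c_{31}^{-\varepsilon}},\quad a_{13}^{c_{21}^{\varepsilon}}=a_{13}^{c_{22}^{\varepsilon}c_{31}^{-\varepsilon}},\quad b_{31}^{c_{21}^{\varepsilon}}=b_{31},\quad b_{22}^{c_{21}^{\varepsilon}}=b_{22}^{c_{22}^{\varepsilon}c_{31}^{-\varepsilon}},\quad b_{13}^{c_{21}^{\varepsilon}}=b_{13}^{c_{22}^{\varepsilon}c_{31}^{-\varepsilon}};$$ 3) conjugations by $c_{12}^{\varepsilon}$: $$a_{31}^{c_{12}^{\varepsilon}}=a_{31},\quad a_{13}^{c_{12}^{\varepsilon}}=a_{13}^{c_{13}^{\varepsilon}c_{31}^{-\varepsilon}},\quad b_{31}^{c_{12}^{\varepsilon}}=b_{31},\quad b_{13}^{c_{12}^{\varepsilon}}=b_{13}^{c_{13}^{\varepsilon}c_{31}^{-\varepsilon}},$$ $$a_{22}^{c_{12}^{-1}}=a_{13}^{c_{13}^{-1}c_{31}}\,a_{13}^{-c_{13}^{-1}c_{22}}\,a_{22}\,[c_{21},c_{12}^{-1}],\qquad a_{22}^{c_{12}}=[c_{12},c_{21}^{-1}]\,a_{13}^{-c_{13}c_{22}^{-1}}\,a_{22}\,a_{13}^{c_{13}c_{31}^{-1}},$$ $$b_{22}^{c_{12}^{-1}}=b_{13}^{c_{13}^{-1}c_{31}}\,b_{22}\,b_{13}^{-c_{13}^{-1}c_{22}}\,[c_{21},c_{12}^{-1}],\qquad b_{22}^{c_{12}}=[c_{12},c_{21}^{-1}]\,b_{22}\,b_{13}^{-c_{13}c_{22}^{-1}}\,b_{13}^{c_{13}c_{31}^{-1}};$$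 4) commutativity relations: $$[a_{21},a_{12}]=[a_{31},a_{22}]=[a_{31},a_{13}]=[a_{22},a_{13}]=1,$$ $$[c_{21}a_{21}^{-1},c_{12}a_{12}^{-1}]=[b_{31},b_{22}]=[b_{31},b_{13}]=[b_{22},b_{13}]=1.$$
   Context: Conventions: $x^{y}=y^{-1}xy$, $x^{-y}=(x^{y})^{-1}$, $[x,y]=x^{-1}y^{-1}xy$. $VP_4$ is the virtual pure braid group on $4$ strands: it has generators $\lambda_{ij}$, $1\le i\ne j\le 4$, and defining relations $\lambda_{ij}\lambda_{kl}=\lambda_{kl}\lambda_{ij}$ and $\lambda_{ki}\lambda_{kj}\lambda_{ij}=\lambda_{ij}\lambda_{kj}\lambda_{ki}$, where distinct letters stand for distinct indices. Elements of $VP_4$: $a_{11}=\lambda_{12}$, $b_{11}=\lambda_{21}$, $a_{21}=\lambda_{13}\lambda_{23}$, $a_{12}=\lambda_{13}\lambda_{12}$, $b_{21}=\lambda_{32}\lambda_{31}$, $b_{12}=\lambda_{21}\lambda_{31}$, $a_{31}=\lambda_{14}\lambda_{24}\lambda_{34}$, $a_{22}=\lambda_{14}\lambda_{24}\lambda_{13}\lambda_{23}$, $a_{13}=\lambda_{14}\lambda_{13}\lambda_{12}$, $b_{31}=\lambda_{43}\lambda_{42}\lambda_{41}$, $b_{22}=\lambda_{32}\lambda_{31}\lambda_{42}\lambda_{41}$, $b_{13}=\lambda_{21}\lambda_{31}\lambda_{41}$, and $c_{ij}=b_{ij}a_{ij}$ for all these index pairs. The associated subgroups are $$A=\langle a_{21}a_{22}^{-1}a_{31},\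 a_{12}a_{13}^{-1}a_{22}a_{21}^{-1},\ a_{13}a_{12}^{-1},\ b_{31}b_{22}^{-1}b_{21},\ b_{21}^{-1}b_{22}b_{13}^{-1}b_{12},\ b_{12}^{-1}b_{13}\rangle,$$ $$B=\langle a_{21}a_{22}^{-1}a_{31},\ (a_{12}a_{13}^{-1}a_{22}a_{21}^{-1})^{a_{12}},\ (a_{13}a_{12}^{-1})^{a_{21}^{-1}a_{12}},\ b_{31}b_{22}^{-1}b_{21},\ (b_{21}^{-1}b_{22}b_{13}^{-1}b_{12})^{a_{12}},\ (b_{12}^{-1}b_{13})^{a_{21}^{-1}a_{12}}\rangle,$$ where, in $G_4$, $b_{21}=c_{21}a_{21}^{-1}$ and $b_{12}=c_{12}a_{12}^{-1}$. (In terms of the $\lambda$'s, $A=\langle\lambda_{34},\lambda_{24},\lambda_{14},\lambda_{43},\lambda_{42},\lambda_{41}\rangle$.) *)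

(* Defs.v *)
From HB Require Import structures.
From mathcomp Require Import all_boot.
From mathcomp Require Import boolp classical_sets functions.

Set Implicit Arguments.
Unset Strict Implicit.
Unset Printing Implicit Defensive.

Local Open Scope quotient_scope.
Local Open Scope classical_set_scope.
Local Open Scope group_scope.

Section Subgroups.
Variable G : groupType.

Definition subgroup (H : set G) : Prop := group_closed [in H].

Definition normal_subgroup (N : set G) : Prop :=
  subgroup N /\ forall x y, N x -> N (x ^ y).

Definition gen_subgroup (S : set G) : set G := smallest subgroup S.

Definition normal_closure (S : set G) : set G := smallest normal_subgroup S.

Lemma subgroupP (H : set G) :
  subgroup H <-> H 1 /\ (forall x y, H x -> H y -> H (x * y^-1)).
Proof.
split=> -[H1 HB]; split.
- by rewrite inE in H1.
- by move=> x y Hx Hy; have := HB x y; rewrite !inE; apply.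
- by rewrite !inE.
- by move=> x y; rewrite !inE; apply: HB.
Qed.

Lemma normal_closure_normal (S : set G) : normal_subgroup (normal_closure S).
Proof.
split.
  apply/subgroupP; split=> [N [[/subgroupP[N1 _] _] _] //|x y Sx Sy N NN].
  have [[/subgroupP[_ NB] _] _] := NN.
  by apply: NB; [apply: Sx|apply: Sy].
move=> x y Sx N NN; have [[_ NJ] _] := NN.
by apply: NJ; apply: Sx.
Qed.

Lemma sub_normal_closure (S : set G) : S `<=` normal_closure S.
Proof. exact: sub_gen_smallest. Qed.

End Subgroups.

Section FreeGroup.
Variable X : choiceType.

(* The letter (x, false) stands for x and (x, true) for its inverse. *)
Definition word : Type := seq (X * bool).

Inductive word_eq : word -> word -> Prop :=
| word_eq_refl s : word_eq s s
| word_eq_sym s t : word_eq s t -> word_eq t s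
| word_eq_trans s t u : word_eq s t -> word_eq t u -> word_eq s u
| word_eq_cat s s' t t' :
    word_eq s s' -> word_eq t t' -> word_eq (s ++ t) (s' ++ t')
| word_eq_cancel x b : word_eq [:: (x, b); (x, ~~ b)] [::].

Definition word_eqb : rel word := fun s t => `[< word_eq s t >].

Lemma word_eqb_equiv : equiv_class_of word_eqb.
Proof.
split=> [s|s t|t s u].
- exact/asboolP/word_eq_refl.
- by apply/asboolP/asboolP => /word_eq_sym.
- by move=> /asboolP st /asboolP tu; apply/asboolP/word_eq_trans/tu.
Qed.

Canonical word_equiv := EquivRelPack word_eqb_equiv.

Definition free_group := {eq_quot word_equiv}.
HB.instance Definition _ := Choice.on free_group.

Definition free_pi (s : word) : free_group := \pi s.
Definition free_repr (u : free_group) : word := repr u.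

Lemma free_reprK u : free_pi (free_repr u) = u.
Proof. exact: reprK. Qed.

Definition word_inv (s : word) : word := rev [seq (l.1, ~~ l.2) | l <- s].

Lemma word_eq_mod s t : word_eq s t <-> free_pi s = free_pi t.
Proof. by split=> [st|/eqmodP/asboolP//]; apply/eqmodP/asboolP. Qed.

Lemma word_eq_repr s : word_eq (free_repr (free_pi s)) s.
Proof. by apply/word_eq_mod; rewrite free_reprK. Qed.

Lemma word_inv_eq s t : word_eq s t -> word_eq (word_inv s) (word_inv t).
Proof.
elim=> {s t} [s|s t _|s t u _ + _|s s' t t' _ IHs _ IHt|x b].
- exact: word_eq_refl.
- exact: word_eq_sym.
- exact: word_eq_trans.
- by rewrite /word_inv !map_cat !rev_cat; apply: word_eq_cat.
- by rewrite /word_inv /rev /= negbK; apply: word_eq_cancel.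
Qed.

Lemma word_invl s : word_eq (word_inv s ++ s) [::].
Proof.
elim: s => [|[x b] s IHs]; first exact: word_eq_refl.
rewrite /word_inv /= rev_cons -cats1 -catA /=.
apply: word_eq_trans IHs; apply: word_eq_cat; first exact: word_eq_refl.
rewrite -[s in X in word_eq _ X]cat0s -[_ :: s]/([:: (x, b)] ++ s).
rewrite -cat1s catA; apply: word_eq_cat; last exact: word_eq_refl.
by have := word_eq_cancel x (~~ b); rewrite negbK.
Qed.

Lemma word_invK s : word_inv (word_inv s) = s.
Proof.
rewrite /word_inv map_rev revK -map_comp map_id_in // => -[x b] _ /=.
by rewrite negbK.
Qed.

Definition free_one : free_group := free_pi [::].
Definition free_mul (u v : free_group) : free_group :=
  free_pi (free_repr u ++ free_repr v).
Definition free_inv (u : free_group) : free_group :=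
  free_pi (word_inv (free_repr u)).

Lemma free_mul_pi s t :
  free_mul (free_pi s) (free_pi t) = free_pi (s ++ t).
Proof. by apply/word_eq_mod; apply: word_eq_cat; apply: word_eq_repr. Qed.

Lemma free_inv_pi s :
  free_inv (free_pi s) = free_pi (word_inv s).
Proof. by apply/word_eq_mod/word_inv_eq/word_eq_repr. Qed.

Fact free_mulA : associative free_mul.
Proof.
move=> u v w; rewrite -[u]free_reprK -[v]free_reprK -[w]free_reprK.
by rewrite !free_mul_pi catA.
Qed.

Fact free_mul1 : left_id free_one free_mul.
Proof. by move=> u; rewrite -[u]free_reprK free_mul_pi. Qed.

Fact free_mulr1 : right_id free_one free_mul.
Proof. by move=> u; rewrite -[u]free_reprK free_mul_pi cats0. Qed.

Fact free_mulV : left_inverse free_one free_inv free_mul.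
Proof.
move=> u; rewrite -[u]free_reprK free_inv_pi free_mul_pi.
exact/word_eq_mod/word_invl.
Qed.

Fact free_mulrV : right_inverse free_one free_inv free_mul.
Proof.
move=> u; rewrite -[u]free_reprK free_inv_pi free_mul_pi.
by apply/word_eq_mod; rewrite -{1}[free_repr u]word_invK; apply: word_invl.
Qed.

HB.instance Definition _ := isGroup.Build free_group
  free_mulA free_mul1 free_mulr1 free_mulV free_mulrV.

Definition letter (x : X) : free_group := free_pi [:: (x, false)].

Variables (G : groupType) (f : X -> G).

Definition word_eval (s : word) : G :=
  foldr (fun l v => (if l.2 then (f l.1)^-1 else f l.1) * v) 1 s.

Definition free_lift (u : free_group) : G := word_eval (free_repr u).

Lemma word_eval_cat s t : word_eval (s ++ t) = word_eval s * word_eval t.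
Proof. by elim: s => [|l s IHs] /=; rewrite ?mul1g // IHs mulgA. Qed.

Lemma word_eval_eq s t : word_eq s t -> word_eval s = word_eval t.
Proof.
elim=> {s t} //= [s t u _ -> //|s s' t t' _ es _ et|x b].
  by rewrite !word_eval_cat es et.
by case: b => /=; rewrite mulg1 ?mulgV ?mulVg.
Qed.

Lemma free_lift_pi s : free_lift (free_pi s) = word_eval s.
Proof. exact/word_eval_eq/word_eq_repr. Qed.

Lemma free_liftM u v : free_lift (u * v) = free_lift u * free_lift v.
Proof. by rewrite [LHS]free_lift_pi word_eval_cat. Qed.

Fact free_lift_morph : monoid_morphism free_lift.
Proof. by split; [apply: free_lift_pi|apply: free_liftM]. Qed.

HB.instance Definition _ :=
  isUMagmaMorphism.Build free_group G free_lift free_lift_morph.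

Lemma free_lift_letter x : free_lift (letter x) = f x.
Proof. by rewrite free_lift_pi /= mulg1. Qed.

End FreeGroup.

Section Presentation.
Variables (X : choiceType) (R : free_group X -> free_group X -> Prop).

(* R u v stands for the defining relation u = v. *)
Definition relators : set (free_group X) :=
  [set r | exists u v, R u v /\ r = u * v^-1].

(* The subgroup H of G is presented by < X | R >, the letter x denoting f x. *)
Definition presents (G : groupType) (H : set G) (f : X -> G) : Prop :=
  range (free_lift f) = H /\
  [set u | free_lift f u = 1] = normal_closure relators.

Definition pres_eqb : rel (free_group X) :=
  fun u v => `[< normal_closure relators (u * v^-1) >].

Let N := normal_closure relators.
Let N1 : N 1.
Proof. by case: (normal_closure_normal relators) => /subgroupP[]. Qed.
Let ND u v : N u -> N v -> N (u * v^-1).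
Proof.
by case: (normal_closure_normal relators) => /subgroupP[_ +] _; apply.
Qed.
Let NV u : N u -> N u^-1.
Proof. by move=> Nu; rewrite -[_^-1]mul1g; apply: (ND N1 Nu). Qed.
Let NM u v : N u -> N v -> N (u * v).
Proof. by move=> Nu Nv; rewrite -[v]invgK; apply: (ND Nu (NV Nv)). Qed.
Let NJ u v : N u -> N (u ^ v).
Proof. by case: (normal_closure_normal relators) => _; apply. Qed.

Lemma pres_eqb_equiv : equiv_class_of pres_eqb.
Proof.
have sym u v : N (u * v^-1) -> N (v * u^-1).
  by move=> /NV; rewrite invgM invgK.
split=> [u|u v|v u w].
- by apply/asboolP; rewrite mulgV.
- by apply/asboolP/asboolP; apply: sym.
- move=> /asboolP uv /asboolP vw; apply/asboolP.
  by have := NM uv vw; rewrite mulgA mulgVK.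
Qed.

Canonical pres_equiv := EquivRelPack pres_eqb_equiv.

Definition presented_group := {eq_quot pres_equiv}.
HB.instance Definition _ := Choice.on presented_group.

Definition pres_pi (u : free_group X) : presented_group := \pi u.
Definition pres_repr (x : presented_group) : free_group X := repr x.

Lemma pres_reprK x : pres_pi (pres_repr x) = x.
Proof. exact: reprK. Qed.

Lemma pres_eqP u v :
  N (u * v^-1) <-> pres_pi u = pres_pi v.
Proof. by split=> [uv|/eqmodP/asboolP//]; apply/eqmodP/asboolP. Qed.

Lemma pres_reprP u : N (pres_repr (pres_pi u) * u^-1).
Proof. by apply/pres_eqP; rewrite pres_reprK. Qed.

Definition pres_one : presented_group := pres_pi 1.
Definition pres_mul (u v : presented_group) : presented_group :=
  pres_pi (pres_repr u * pres_repr v).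
Definition pres_inv (u : presented_group) : presented_group :=
  pres_pi (pres_repr u)^-1.

Lemma pres_mul_pi u v : pres_mul (pres_pi u) (pres_pi v)
  = pres_pi (u * v).
Proof.
apply/pres_eqP; set u' := pres_repr _; set v' := pres_repr _.
have -> : u' * v' * (u * v)^-1 = (v' * v^-1) ^ (u'^-1) * (u' * u^-1).
  by rewrite /conjg invgM invgK !mulgA mulgVK.
exact: (NM (NJ _ (pres_reprP _)) (pres_reprP _)).
Qed.

Lemma pres_inv_pi u :
  pres_inv (pres_pi u) = pres_pi u^-1.
Proof.
apply/pres_eqP; set u' := pres_repr _; rewrite invgK.
have -> : u'^-1 * u = ((u' * u^-1)^-1) ^ u.
  by rewrite /conjg invgM invgK !mulgA mulVg mul1g.
exact: (NJ _ (NV (pres_reprP _))).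
Qed.

Fact pres_mulA : associative pres_mul.
Proof.
move=> u v w; rewrite -[u]pres_reprK -[v]pres_reprK -[w]pres_reprK.
by rewrite !pres_mul_pi mulgA.
Qed.

Fact pres_mul1 : left_id pres_one pres_mul.
Proof. by move=> u; rewrite -[u]pres_reprK pres_mul_pi mul1g. Qed.

Fact pres_mulr1 : right_id pres_one pres_mul.
Proof. by move=> u; rewrite -[u]pres_reprK pres_mul_pi mulg1. Qed.

Fact pres_mulV : left_inverse pres_one pres_inv pres_mul.
Proof. by move=> u; rewrite -[u]pres_reprK pres_inv_pi pres_mul_pi mulVg. Qed.

Fact pres_mulrV : right_inverse pres_one pres_inv pres_mul.
Proof. by move=> u; rewrite -[u]pres_reprK pres_inv_pi pres_mul_pi mulgV. Qed.

HB.instance Definition _ := isGroup.Build presented_group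
  pres_mulA pres_mul1 pres_mulr1 pres_mulV pres_mulrV.

Definition pres_gen (x : X) : presented_group := pres_pi (letter x).

Lemma pres_lift u : free_lift pres_gen u = pres_pi u.
Proof.
have piM a b : pres_pi (a * b) =
    pres_pi a * pres_pi b by rewrite -pres_mul_pi.
have piV a : pres_pi a^-1 = (pres_pi a)^-1.
  by rewrite -pres_inv_pi.
rewrite -[u]free_reprK free_lift_pi; elim: (free_repr u) => [|[x b] s IHs] //=.
have -> : free_pi ((x, b) :: s) = free_pi [:: (x, b)] * free_pi s.
  by rewrite -cat1s -free_mul_pi.
rewrite piM IHs; congr (_ * _); case: b => //.
by rewrite -piV; congr pres_pi; apply: free_inv_pi.
Qed.

Lemma presented_groupP : presents [set: presented_group] pres_gen.
Proof.
split; apply/seteqP; split=> // u.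
- by move=> _; exists (pres_repr u) => //; rewrite pres_lift pres_reprK.
- by rewrite /= pres_lift => /pres_eqP; rewrite invg1 mulg1.
- by move=> Nu; rewrite /= pres_lift; apply/pres_eqP; rewrite invg1 mulg1.
Qed.

End Presentation.

Section HNN.
Variables (V : groupType) (G A B : set V) (phi : V -> V) (t : V).

(* The relations of < G, t | t^-1 a t = phi a for a in A >: the letter Some g
   stands for the element g of G, and None for t. *)
Inductive hnn_rel : free_group (option G) -> free_group (option G) -> Prop :=
| hnn_table (x y z : G) : val x * val y = val z ->
    hnn_rel (letter (Some x) * letter (Some y)) (letter (Some z))
| hnn_stable (x y : G) : A (val x) -> phi (val x) = val y ->
    hnn_rel (letter (Some x) ^ letter None) (letter (Some y)).

Definition hnn_val (g : option G) : V := if g is Some x then val x else t.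

Record HNN_extension : Prop := {
  hnn_base : subgroup G;
  hnn_assocA : subgroup A;
  hnn_assocB : subgroup B;
  hnn_subA : A `<=` G;
  hnn_subB : B `<=` G;
  hnn_morph : forall x y, A x -> A y -> phi (x * y) = phi x * phi y;
  hnn_bij : set_bij A B phi;
  hnn_presents : presents hnn_rel [set: V] hnn_val
}.

End HNN.

Section VirtualPureBraid.
Variable n : nat.

(* Strands are numbered from 1 to n. *)
Definition vgen : Type :=
  {p : nat * nat | [&& 0 < p.1 <= n, 0 < p.2 <= n & p.1 != p.2]}.
HB.instance Definition _ := Choice.on vgen.

(* 1 is a junk value, for i = j or an index out of range. *)
Definition free_lam (i j : nat) : free_group vgen :=
  if insub (i, j) is Some p then letter p else 1.

Definition strands (s : seq nat) : bool :=
  uniq s && all (fun i => 0 < i <= n) s.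

Inductive VP_rel : free_group vgen -> free_group vgen -> Prop :=
| VP_comm i j k l : strands [:: i; j; k; l] ->
    VP_rel (free_lam i j * free_lam k l) (free_lam k l * free_lam i j)
| VP_braid i j k : strands [:: i; j; k] ->
    VP_rel (free_lam k i * free_lam k j * free_lam i j)
           (free_lam i j * free_lam k j * free_lam k i).

Definition VP : Type := presented_group VP_rel.
HB.instance Definition _ := Group.on VP.

Definition lam (i j : nat) : VP :=
  free_lift (@pres_gen _ VP_rel) (free_lam i j).

Lemma VP_rel_lift u v : VP_rel u v ->
  free_lift (@pres_gen _ VP_rel) u = free_lift (@pres_gen _ VP_rel) v.
Proof.
move=> r; rewrite !pres_lift; apply/pres_eqP; apply: sub_normal_closure.
by exists u, v.
Qed.

Lemma lam_comm i j k l : strands [:: i; j; k; l] ->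
  lam i j * lam k l = lam k l * lam i j.
Proof. by move=> /VP_comm/VP_rel_lift; rewrite !free_liftM. Qed.

Lemma lam_braid i j k : strands [:: i; j; k] ->
  lam k i * lam k j * lam i j = lam i j * lam k j * lam k i.
Proof. by move=> /VP_braid/VP_rel_lift; rewrite !free_liftM. Qed.

End VirtualPureBraid.

Notation VP4 := (VP 4).

Module Elements.

Local Notation "'λ' i j" := (lam 4 i j) (at level 10, i, j at level 9).

Definition a11 : VP4 := λ 1 2.
Definition b11 : VP4 := λ 2 1.
Definition a21 : VP4 := λ 1 3 * λ 2 3.
Definition a12 : VP4 := λ 1 3 * λ 1 2.
Definition b21 : VP4 := λ 3 2 * λ 3 1.
Definition b12 : VP4 := λ 2 1 * λ 3 1.
Definition a31 : VP4 := λ 1 4 * λ 2 4 * λ 3 4.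
Definition a22 : VP4 := λ 1 4 * λ 2 4 * λ 1 3 * λ 2 3.
Definition a13 : VP4 := λ 1 4 * λ 1 3 * λ 1 2.
Definition b31 : VP4 := λ 4 3 * λ 4 2 * λ 4 1.
Definition b22 : VP4 := λ 3 2 * λ 3 1 * λ 4 2 * λ 4 1.
Definition b13 : VP4 := λ 2 1 * λ 3 1 * λ 4 1.
Definition c11 : VP4 := b11 * a11.
Definition c21 : VP4 := b21 * a21.
Definition c12 : VP4 := b12 * a12.

Definition A_gens : seq VP4 :=
  [:: a21 * a22^-1 * a31;
      a12 * a13^-1 * a22 * a21^-1;
      a13 * a12^-1;
      b31 * b22^-1 * b21;
      b21^-1 * b22 * b13^-1 * b12;
      b12^-1 * b13].

Definition B_gens : seq VP4 :=
  [:: a21 * a22^-1 * a31;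
      (a12 * a13^-1 * a22 * a21^-1) ^ a12;
      (a13 * a12^-1) ^ (a21^-1 * a12);
      b31 * b22^-1 * b21;
      (b21^-1 * b22 * b13^-1 * b12) ^ a12;
      (b12^-1 * b13) ^ (a21^-1 * a12)].

Definition A : set VP4 := gen_subgroup [set` A_gens].
Definition B : set VP4 := gen_subgroup [set` B_gens].

End Elements.

Inductive g4_gen : Type :=
  C11 | A21 | A12 | C21 | C12 | A31 | A22 | A13 | B31 | B22 | B13.
HB.instance Definition _ := gen_eqMixin g4_gen.
HB.instance Definition _ := gen_choiceMixin g4_gen.

Definition g4_val (g : g4_gen) : VP4 :=
  match g with
  | C11 => Elements.c11 | A21 => Elements.a21 | A12 => Elements.a12
  | C21 => Elements.c21 | C12 => Elements.c12
  | A31 => Elements.a31 | A22 => Elements.a22 | A13 => Elements.a13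
  | B31 => Elements.b31 | B22 => Elements.b22 | B13 => Elements.b13
  end.

Definition G4 : set VP4 := gen_subgroup (range g4_val).

Section G4Relations.

Let c11 := letter C11.
Let a21 := letter A21.
Let a12 := letter A12.
Let c21 := letter C21.
Let c12 := letter C12.
Let a31 := letter A31.
Let a22 := letter A22.
Let a13 := letter A13.
Let b31 := letter B31.
Let b22 := letter B22.
Let b13 := letter B13.
Let c31 := b31 * a31.
Let c22 := b22 * a22.
Let c13 := b13 * a13.

(* In the next three lists, p c is the power c^eps and m c the power c^(-eps),
   for a sign eps. *)
Section Signed.
Variable p m : free_group g4_gen -> free_group g4_gen.

Definition g4_conj_c11 : seq (free_group g4_gen * free_group g4_gen) :=
  [:: (a21 ^ p c11, a21);
      (a12 ^ p c11, a12 ^ (p c12 * m c21));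
      (c21 ^ p c11, c21);
      (c12 ^ p c11, c12 ^ m c21);
      (a31 ^ p c11, a31);
      (a22 ^ p c11, a22);
      (a13 ^ p c11, a13 ^ (p c13 * m c22));
      (b31 ^ p c11, b31);
      (b22 ^ p c11, b22);
      (b13 ^ p c11, b13 ^ (p c13 * m c22))].

Definition g4_conj_c21 : seq (free_group g4_gen * free_group g4_gen) :=
  [:: (a31 ^ p c21, a31);
      (a22 ^ p c21, a22 ^ (p c22 * m c31));
      (a13 ^ p c21, a13 ^ (p c22 * m c31));
      (b31 ^ p c21, b31);
      (b22 ^ p c21, b22 ^ (p c22 * m c31));
      (b13 ^ p c21, b13 ^ (p c22 * m c31))].

Definition g4_conj_c12 : seq (free_group g4_gen * free_group g4_gen) :=
  [:: (a31 ^ p c12, a31);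
      (a13 ^ p c12, a13 ^ (p c13 * m c31));
      (b31 ^ p c12, b31);
      (b13 ^ p c12, b13 ^ (p c13 * m c31))].

Definition g4_conj := g4_conj_c11 ++ g4_conj_c21 ++ g4_conj_c12.

End Signed.

Definition g4_conj_c12_22 : seq (free_group g4_gen * free_group g4_gen) :=
  [:: (a22 ^ c12^-1,
       a13 ^ (c13^-1 * c31) * (a13 ^ (c13^-1 * c22))^-1 * a22
       * [~ c21, c12^-1]);
      (a22 ^ c12,
       [~ c12, c21^-1] * (a13 ^ (c13 * c22^-1))^-1 * a22
       * a13 ^ (c13 * c31^-1));
      (b22 ^ c12^-1,
       b13 ^ (c13^-1 * c31) * b22 * (b13 ^ (c13^-1 * c22))^-1
       * [~ c21, c12^-1]);
      (b22 ^ c12,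
       [~ c12, c21^-1] * b22 * (b13 ^ (c13 * c22^-1))^-1
       * b13 ^ (c13 * c31^-1))].

Definition g4_comm : seq (free_group g4_gen * free_group g4_gen) :=
  [:: ([~ a21, a12], 1);
      ([~ a31, a22], 1);
      ([~ a31, a13], 1);
      ([~ a22, a13], 1);
      ([~ c21 * a21^-1, c12 * a12^-1], 1);
      ([~ b31, b22], 1);
      ([~ b31, b13], 1);
      ([~ b22, b13], 1)].

Definition g4_rels : seq (free_group g4_gen * free_group g4_gen) :=
  g4_conj id (fun c => c^-1) ++ g4_conj (fun c => c^-1) id
    ++ g4_conj_c12_22 ++ g4_comm.

Definition g4_rel (u v : free_group g4_gen) : Prop := (u, v) \in g4_rels.

End G4Relations.

(* Main.v *)
(* Write l_ij for the generators of VP_4. The relations of VP_3 on the l_ij with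
   i, j < 4 are equivalent to the relations of a "cable system" on the words
   c11, a21, a12, b21, b12. Doubling the third, the first or the second strand
   turns the generators of VP_3 into words of VP_4, and the relations of G_4 are
   essentially the three resulting cable systems and the undoubled one. A word
   computation then shows that, in any group, the relations of VP_4 on the l_ij
   amount to those of G_4 on the corresponding words, together with the fact that
   conjugation by t = a11 maps the generators of A to those of B. This gives the
   presentation of VP_4 as an HNN-extension of G_4.

   To see that G_4 satisfies no other relation, let Gamma be the group presented
   by those of the theorem. If the two lists of six generators are both free in
   Gamma, then Gamma acts faithfully on a set carrying a bijection t conjugating
   the first list into the second one, whence a representation of VP_4 whose
   restriction to G_4 recovers Gamma. Freeness can be checked in VP_4, where the
   first list is formed by the l_i4 and l_4i: VP_4 acts on the free group with
   basis x_i, y_i (i < 4), where l_i4 and l_4i act as translations by x_i and y_i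
   and the other l_ij as automorphisms. *)
From HB Require Import structures.
Require Import Defs.
From mathcomp Require Import all_boot.
From mathcomp Require Import boolp classical_sets functions.

Set Implicit Arguments.
Unset Strict Implicit.
Unset Printing Implicit Defensive.

Local Open Scope classical_set_scope.
Local Open Scope group_scope.

(** * Yang-Baxter systems on three strands *)

Section YangBaxter.
Variable H : groupType.
Implicit Types x y z u v p q a b c : H.

Definition yb x y z := x * y * z = z * y * x.

Lemma yb_sym x y z : yb x y z -> yb z y x.
Proof. exact: esym. Qed.

(** A pair of rewrite rules: the first component also applies after a prefix [w], as left-associated
    products require. *)
Lemma ybE x y z : yb x y z ->
  (forall w, w * x * y * z = w * z * y * x) * (x * y * z = z * y * x).
Proof. by move=> h; split=> // w; rewrite -!mulgA !(mulgA _ y) h. Qed.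

Lemma commE x y : commute x y -> (forall w, w * x * y = w * y * x) * (x * y = y * x).
Proof. by move=> h; split=> // w; rewrite -!mulgA h. Qed.

Lemma eq_in_context u v p q x y :
  x = u * p * v -> y = u * q * v -> (x = y <-> p = q).
Proof. by move=> -> ->; split=> [/mulIg/mulgI|->]. Qed.

Definition yb3 x12 x21 x13 x31 x23 x32 : Prop :=
  [/\ yb x12 x13 x23, yb x21 x23 x13, yb x32 x31 x21 & yb x31 x32 x12] /\
  (yb x13 x12 x32 /\ yb x23 x21 x31).

(** The last two conditions say that [c] acts on [a'] and [b'] by conjugation as
    [b' * a' * (b * a)^-1] does, which is the shape of the relations of G_4. *)
Definition cable_rels c a a' b b' : Prop :=
  let w := b' * a' * (b * a)^-1 * c^-1 in
  [/\ commute a a', commute b b', commute a c & commute b c] /\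
  (commute a' w /\ commute b' w).

Lemma commVE x y : commute x y^-1 <-> commute x y.
Proof. by split=> [/commuteV|/commuteV //]; rewrite invgK. Qed.

Lemma commute_conj x y z : commute (x ^ z) (y ^ z) <-> commute x y.
Proof. by rewrite /commute -!conjMg; split=> [/conjg_inj|->]. Qed.

(* The word [w] of [cable_rels] is a conjugate of [(x32 * x23)^-1], and equal to
   it as soon as all the relations hold. *)
Lemma cable_word x12 x21 x13 x31 x23 x32 :
  yb x12 x13 x23 -> yb x32 x31 x21 -> yb x31 x32 x12 ->
  (x21 * x31) * (x13 * x12) * ((x32 * x31) * (x13 * x23))^-1 * (x21 * x12)^-1
    = ((x32 * x23) ^ (x21 * x31)^-1)^-1.
Proof.
move=> h1 h3 h4; rewrite /conjg; apply: invg_inj; rewrite !gnorm.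
have e : x21 * x12 * x32 * x31 * x13 * x23 = x32 * x31 * x21 * x23 * x13 * x12.
  by rewrite -(ybE h4) (ybE (yb_sym h3)) (ybE h1).
by rewrite e !gnorm (ybE h3).
Qed.

(** The first four braid relations match the four commutations one by one ([e1] to [e4]). The last
    two match the commutations with [w], which by then is a conjugate of [(x32 * x23)^-1]. *)
Lemma cableP x12 x21 x13 x31 x23 x32 :
  yb3 x12 x21 x13 x31 x23 x32 <->
  cable_rels (x21 * x12) (x13 * x23) (x13 * x12) (x32 * x31) (x21 * x31).
Proof.
have e1 : yb x12 x13 x23 <-> commute (x13 * x23) (x13 * x12).
  apply: iff_sym; rewrite /commute; split.
    by rewrite -!mulgA => /mulgI; rewrite !mulgA => /esym.
  by move=> h; rewrite !mulgA (ybE h).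
have e2 : yb x32 x31 x21 <-> commute (x32 * x31) (x21 * x31).
  split=> [h|]; first by rewrite /commute !mulgA (ybE h).
  by rewrite /commute !mulgA => /mulIg.
have e3 : yb x12 x13 x23 -> yb x21 x23 x13 <-> commute (x13 * x23) (x21 * x12).
  move=> h; apply: iff_sym; rewrite /commute; split; last first.
    by move=> k; rewrite !mulgA (ybE h) -(ybE k).
  by rewrite !mulgA (ybE h) => /mulIg/esym.
have e4 : yb x32 x31 x21 -> yb x31 x32 x12 <-> commute (x32 * x31) (x21 * x12).
  move=> h; apply: iff_sym; rewrite /commute; split; last first.
    by move=> k; rewrite !mulgA (ybE h) -(ybE k).
  by rewrite !mulgA (ybE h) -!mulgA => /mulgI; rewrite !mulgA.
rewrite /yb3 /cable_rels.
suff e5 : yb x12 x13 x23 -> yb x32 x31 x21 -> yb x31 x32 x12 ->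
    (yb x13 x12 x32 /\ yb x23 x21 x31) <->
    (commute (x13 * x12) (x21 * x31 * (x13 * x12) * (x32 * x31 * (x13 * x23))^-1
       * (x21 * x12)^-1) /\
     commute (x21 * x31) (x21 * x31 * (x13 * x12) * (x32 * x31 * (x13 * x23))^-1
       * (x21 * x12)^-1)).
  split=> [[[h1 h2 h3 h4] h5]|[[h1 h2 h3 h4] h5]].
    by split; [split; tauto|apply/(e5 h1 h3 h4)].
  move: h1 h2 => /e1 k1 /e2 k3; move: h3 h4 => /(e3 k1) k2 /(e4 k3) k4.
  by split; [split|apply/(e5 k1 k3 k4)].
move=> h1 h3 h4; rewrite (cable_word h1 h3 h4) !commVE.
have f1 : yb x23 x21 x31 <-> commute (x21 * x31) (x32 * x23).
  apply: iff_sym; rewrite /commute.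
  have -> : x21 * x31 * (x32 * x23) = x32 * (x31 * x21 * x23) by rewrite !mulgA (ybE h3).
  have -> : x32 * x23 * (x21 * x31) = x32 * (x23 * x21 * x31) by rewrite !mulgA.
  by split=> [/mulgI/esym|->].
have f2 : yb x13 x12 x32 <-> commute (x13 * x12) (x32 * x23).
  apply: iff_sym; rewrite /commute.
  have -> : x32 * x23 * (x13 * x12) = (x32 * x12 * x13) * x23
    by rewrite !mulgA (ybE (yb_sym h1)).
  have -> : x13 * x12 * (x32 * x23) = (x13 * x12 * x32) * x23 by rewrite !mulgA.
  by split=> [/mulIg|->].
(* The conjugating element is the inverse of [x21 * x31] itself, so this commutation can be read on
   [x32 * x23]. Once it holds, [f4] removes the conjugation for the other relation too. *)
have f3 : commute (x21 * x31) ((x32 * x23) ^ (x21 * x31)^-1) <->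
          commute (x21 * x31) (x32 * x23).
  by rewrite -[X in commute X (_ ^ _)](_ : (x21 * x31) ^ (x21 * x31)^-1 = _)
    ?commute_conj // /conjg !gnorm.
have f4 : commute (x21 * x31) (x32 * x23) ->
    (x32 * x23) ^ (x21 * x31)^-1 = x32 * x23.
  by move=> k; rewrite /conjg invgK (mulgA _ _ _^-1) k mulgK.
rewrite f3; split=> [[/f2 ? /f1 k]|[k2 k1]]; first by rewrite f4.
by move: k2; rewrite f4 // => /f2; split=> //; apply/f1.
Qed.

Lemma cable_word_full x12 x21 x13 x31 x23 x32 :
  yb3 x12 x21 x13 x31 x23 x32 ->
  (x21 * x31) * (x13 * x12) * ((x32 * x31) * (x13 * x23))^-1 * (x21 * x12)^-1
    = (x32 * x23)^-1.
Proof.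
move=> [[h1 h2 h3 h4] [h5 h6]]; rewrite cable_word //; congr _^-1.
rewrite /conjg invgK !mulgA.
by rewrite (ybE (yb_sym h3)) (ybE (yb_sym h6)) !gnorm.
Qed.

End YangBaxter.

(** * Doubling a strand *)

Definition vp4_rels (H : groupType) (l : nat -> nat -> H) : Prop :=
  (forall i j k, strands 4 [:: i; j; k] -> yb (l k i) (l k j) (l i j)) /\
  (forall i j k m, strands 4 [:: i; j; k; m] -> commute (l i j) (l k m)).

(* The last two equations stand for the relations expressing the conjugates of
   a22 and b22 by c12, where the conjugates of a13 and b13 by powers of
   c13 c22^-1 and c13 c31^-1 have been replaced with those by c11 and c12. *)
Definition reduced_rels (H : groupType)
    (c11 a21 a12 b21 b12 a31 a22 a13 b31 b22 b13 : H) : Prop :=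
  let c21 := b21 * a21 in
  let c12 := b12 * a12 in
  let w2 := (b22 * a22) * (b31 * a31)^-1 * c21^-1 in
  [/\ [/\ cable_rels c11 a21 a12 b21 b12, cable_rels c11 a22 a13 b22 b13,
          cable_rels c21 a31 a22 b31 b22 & cable_rels c12 a31 a13 b31 b13],
      commute a31 c11 /\ commute b31 c11,
      commute a13 w2 /\ commute b13 w2 &
      c11 * (a13^-1 * a22) * c12 = c12 * (a13^-1 * a22) * c11 /\
      c11 * (b22 * b13^-1) * c12 = c12 * (b22 * b13^-1) * c11].

Section FourStrands.
Variables (H : groupType) (l : nat -> nat -> H).

Local Notation l12 := (l 1 2).
Local Notation l21 := (l 2 1).
Local Notation l13 := (l 1 3).
Local Notation l31 := (l 3 1).
Local Notation l23 := (l 2 3).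
Local Notation l32 := (l 3 2).
Local Notation l14 := (l 1 4).
Local Notation l41 := (l 4 1).
Local Notation l24 := (l 2 4).
Local Notation l42 := (l 4 2).
Local Notation l34 := (l 3 4).
Local Notation l43 := (l 4 3).

(** In [l_ki l_kj l_ij = l_ij l_kj l_ki], strand 4 is [k] in [yb_b], [j] in [yb_a] and [i] in
    [yb_m]. *)
Let yb_b i j := yb (l 4 i) (l 4 j) (l i j).
Let yb_a i j := yb (l i j) (l i 4) (l j 4).
Let yb_m i j := yb (l i 4) (l i j) (l 4 j).

(* [dbln] states the relations of VP_3 for the words obtained by doubling the
   [n]-th of three strands. *)
Let dbl3 := yb3 l12 l21 (l14 * l13) (l31 * l41) (l24 * l23) (l32 * l42).
Let dbl1 := yb3 (l13 * l23) (l32 * l31) (l14 * l24) (l42 * l41) l34 l43.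
Let dbl2 := yb3 (l13 * l12) (l21 * l31) l14 l41 (l24 * l34) (l43 * l42).

Let c11 := l21 * l12.
Let a21 := l13 * l23.
Let a12 := l13 * l12.
Let b21 := l32 * l31.
Let b12 := l21 * l31.
Let c21 := b21 * a21.
Let c12 := b12 * a12.
Let a31 := l14 * l24 * l34.
Let a22 := l14 * l24 * l13 * l23.
Let a13 := l14 * l13 * l12.
Let b31 := l43 * l42 * l41.
Let b22 := l32 * l31 * l42 * l41.
Let b13 := l21 * l31 * l41.
Let w2 := (b22 * a22) * (b31 * a31)^-1 * c21^-1.

Definition word_rels : Prop :=
  reduced_rels c11 a21 a12 b21 b12 a31 a22 a13 b31 b22 b13.

(** By [stable_words] below, these express that conjugation by [l12] maps the generators of A to
    those of B. *)
Definition stable_rels : Prop :=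
  [/\ commute l12 l34, commute l12 l43 & commute l13 l24] /\
  [/\ commute l13 l42, commute l23 l14 & commute l23 l41].

Local Tactic Notation "ctx" constr(p) constr(q) :=
  apply: (@eq_in_context _ p q); rewrite ?mul1g ?mulg1 !mulgA.

Section Doubling.

Hypotheses (k1234 : commute l12 l34) (k1243 : commute l12 l43).
Hypotheses (k2134 : commute l21 l34) (k2143 : commute l21 l43).
Hypotheses (k1324 : commute l13 l24) (k1342 : commute l13 l42).
Hypotheses (k3124 : commute l31 l24) (k3142 : commute l31 l42).
Hypotheses (k2314 : commute l23 l14) (k2341 : commute l23 l41).

(** Here and in the lemmas that follow, known relations bring both sides of a doubled relation to a
    common form [u * _ * v]. Cancelling [u] and [v], the arguments of [ctx], leaves a single
    relation of VP_4. *)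
Lemma dbl3_a12 : yb l12 l13 l23 ->
  yb l12 (l14 * l13) (l24 * l23) <-> yb_a 1 2.
Proof.
move=> h; ctx (1 : H) (l13 * l23).
  by rewrite (commE k1324).
by rewrite (commE k2314) -(ybE h).
Qed.

Lemma dbl3_a21 : yb l21 l23 l13 ->
  yb l21 (l24 * l23) (l14 * l13) <-> yb_a 2 1.
Proof.
move=> h; ctx (1 : H) (l23 * l13).
  by rewrite (commE k2314).
by rewrite (commE k1324) -(ybE h).
Qed.

Lemma dbl3_b21 : yb l32 l31 l21 -> yb_b 2 1 ->
  yb (l32 * l42) (l31 * l41) l21 <-> commute l41 l32.
Proof.
move=> h k; apply: iff_trans; last exact: (iff_sym (conj (@esym _ _ _) (@esym _ _ _))).
ctx (l21 * l31) l42 => //.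
by rewrite -(commE k3142) (ybE k) (ybE h).
Qed.

Lemma dbl3_b12 : commute l32 l41 -> yb l31 l32 l12 ->
  yb (l31 * l41) (l32 * l42) l12 <-> yb_b 1 2.
Proof.
move=> h k; ctx (l31 * l32) (1 : H).
  by rewrite (commE h).
by rewrite -(commE k3142) -(ybE k).
Qed.

Lemma dbl3_m12 : yb l13 l12 l32 -> yb_m 1 2 ->
  yb (l14 * l13) l12 (l32 * l42) <-> commute l14 l32.
Proof.
move=> h k; ctx (1 : H) (l12 * l42 * l13); rewrite ?mulgA.
  by rewrite (ybE h) (commE k1342).
by rewrite (ybE k).
Qed.

Lemma dbl3_m21 : yb l23 l21 l31 ->
  yb (l24 * l23) l21 (l31 * l41) <-> yb_m 2 1.
Proof.
move=> h; ctx l31 l23.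
  by rewrite (ybE h) -(commE k3124) (commE k2341).
by [].
Qed.

Lemma dbl1_a23 : yb_a 1 3 ->
  yb (l13 * l23) (l14 * l24) l34 <-> yb_a 2 3.
Proof.
move=> h; ctx (l13 * l14) (1 : H).
  by rewrite (commE k2314).
by rewrite (ybE h) (commE k1324).
Qed.

Lemma dbl1_a32 : commute l32 l14 -> yb_a 3 1 ->
  yb (l32 * l31) l34 (l14 * l24) <-> yb_a 3 2.
Proof.
move=> h k; ctx l14 l31.
  by rewrite (ybE k) (commE h) (commE k3124).
by [].
Qed.

Lemma dbl1_b32 : commute l32 l41 -> yb_b 3 1 ->
  yb l43 (l42 * l41) (l32 * l31) <-> yb_b 3 2.
Proof.
move=> h k; ctx (1 : H) (l41 * l31).
  by rewrite -(commE h).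
by rewrite (commE k3142) (ybE k).
Qed.

Lemma dbl1_b23 : yb_b 1 3 ->
  yb (l42 * l41) l43 (l13 * l23) <-> yb_b 2 3.
Proof.
move=> h; ctx l13 l41.
  by rewrite (ybE h) -(commE k1342) (commE k2341).
by [].
Qed.

Lemma dbl1_m23 : yb_m 1 3 ->
  yb (l14 * l24) (l13 * l23) l43 <-> yb_m 2 3.
Proof.
move=> h; ctx (l14 * l13) (1 : H).
  by rewrite (commE k1324).
by rewrite (commE k2314) (ybE h).
Qed.

Lemma dbl1_m32 : commute l32 l41 -> yb_m 3 1 ->
  yb l34 (l32 * l31) (l42 * l41) <-> yb_m 3 2.
Proof.
move=> h k; ctx (1 : H) (l31 * l41).
  by rewrite (commE k3142).
by rewrite -(commE h) (ybE k).
Qed.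

Lemma dbl2_a13 : yb_a 1 2 ->
  yb (l13 * l12) l14 (l24 * l34) <-> yb_a 1 3.
Proof.
move=> h; ctx l24 l12.
  by rewrite (ybE h) (commE k1324) -(commE k1234).
by [].
Qed.

Lemma dbl2_a31 : yb_a 2 1 ->
  yb (l21 * l31) (l24 * l34) l14 <-> yb_a 3 1.
Proof.
move=> h; ctx (l21 * l24) (1 : H).
  by rewrite (commE k3124).
by rewrite -(commE k2134) (ybE h).
Qed.

Lemma dbl2_b21 : yb_b 3 1 ->
  yb (l43 * l42) l41 (l21 * l31) <-> yb_b 2 1.
Proof.
move=> h; ctx l43 l31.
  by [].
by rewrite -(ybE h) (commE k2143) -(commE k3142).
Qed.

Lemma dbl2_b13 : yb_b 1 2 ->
  yb l41 (l43 * l42) (l13 * l12) <-> yb_b 1 3.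
Proof.
move=> h; ctx (1 : H) (l42 * l12).
  by rewrite (commE k1342).
by rewrite (commE k1243) (ybE h).
Qed.

Lemma dbl2_m12 : yb_m 1 3 ->
  yb l14 (l13 * l12) (l43 * l42) <-> yb_m 1 2.
Proof.
move=> h; ctx (l43 * l13) (1 : H).
  by rewrite (commE k1243) (ybE h).
by rewrite (commE k1342).
Qed.

Lemma dbl2_m31 : yb_m 2 1 ->
  yb (l24 * l34) (l21 * l31) l41 <-> yb_m 3 1.
Proof.
move=> h; ctx (l24 * l21) (1 : H).
  by rewrite (commE k2134).
by rewrite (commE k3124) (ybE h).
Qed.

Lemma w2_a13 : yb_a 1 3 -> commute a13 (l43 * l34) <-> yb_m 1 3.
Proof.
move=> h; ctx (1 : H) (l34 * l12).
  by rewrite (commE k1243) (commE k1234).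
by rewrite (ybE h).
Qed.

Lemma w2_b13 : yb_m 3 1 -> commute b13 (l43 * l34) <-> yb_b 3 1.
Proof.
move=> h; apply: iff_trans; last exact: (iff_sym (conj (@esym _ _ _) (@esym _ _ _))).
ctx l21 l34 => //.
by rewrite -(commE k2134) -(commE k2143) -(ybE h).
Qed.

End Doubling.

(** Since [a31 = a22 * a21^-1 * l34] and the first two factors commute with [c11 = l21 * l12], only
    the commutation of [l34] with [l21] is at stake. *)
Lemma commute_a31 : commute a22 c11 -> commute a21 c11 -> commute l12 l34 ->
  commute a31 c11 <-> commute l21 l34.
Proof.
move=> h1 h2 k; have -> : a31 = a22 * a21^-1 * l34 by rewrite /a22 /a21 !gnorm.
have hh : commute (a22 * a21^-1) c11.
  by apply/commute_sym/commuteM; [|apply/commVE]; apply: commute_sym.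
split=> [h|h]; last first.
  apply/commute_sym/commuteM; first exact: commute_sym.
  by apply: commute_sym; apply: commuteM; apply: commute_sym.
have /commute_sym e : commute c11 l34.
  rewrite -[l34](mulKg (a22 * a21^-1)); apply: commuteM; apply: commute_sym => //.
  by apply/commute_sym/commVE/commute_sym.
rewrite -[l21](mulgK l12); apply/commute_sym/commuteM => //.
by apply/commVE/commute_sym.
Qed.

Lemma commute_b31 : commute b22 c11 -> commute b21 c11 -> commute l12 l43 ->
  commute b31 c11 <-> commute l21 l43.
Proof.
move=> h1 h2 k; have -> : b31 = l43 * (b21^-1 * b22) by rewrite /b22 /b21 !gnorm.
have hh : commute (b21^-1 * b22) c11.
  by apply/commute_sym/commuteM; [apply/commVE|]; apply: commute_sym.
split=> [h|h]; last first.
  apply/commute_sym/commuteM; last exact: commute_sym.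
  by apply: commute_sym; apply: commuteM; apply: commute_sym.
have /commute_sym e : commute c11 l43.
  rewrite -[l43](mulgK (b21^-1 * b22)); apply: commuteM; apply: commute_sym => //.
  by apply/commute_sym/commVE/commute_sym.
rewrite -[l21](mulgK l12); apply/commute_sym/commuteM => //.
by apply/commVE/commute_sym.
Qed.

(** Here [a13^-1 * a22] equals [l12^-1 * l24 * l23]. The relations of VP_3 then make the two sides
    differ only in the order of [l24] and [l31]. *)
Lemma exchange_a : yb3 l12 l21 l13 l31 l23 l32 -> commute l13 l24 ->
  c11 * (a13^-1 * a22) * c12 = c12 * (a13^-1 * a22) * c11 <-> commute l24 l31.
Proof.
move=> [[h1 h2 h3 h4] [h5 h6]] k.
have -> : a13^-1 * a22 = l12^-1 * l24 * l23.
  rewrite /a13 /a22 !gnorm; congr (_ * _); rewrite -!mulgA; congr (_ * _).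
  by rewrite -k mulKg.
rewrite /c11 /c12 /b12 /a12; ctx l21 (l13 * l23 * l21 * l12).
  by rewrite mulgK (ybE h6) (ybE h2).
by rewrite !gnorm (commE k).
Qed.

Lemma exchange_b : yb3 l12 l21 l13 l31 l23 l32 -> commute l13 l42 ->
  c11 * (b22 * b13^-1) * c12 = c12 * (b22 * b13^-1) * c11 <-> commute l42 l31.
Proof.
move=> [[h1 h2 h3 h4] [h5 h6]] k.
rewrite /c11 /c12 /b22 /b13 /b12 /a12.
ctx (l21 * l31 * l13 * l12 * l32) (l31^-1 * l12).
  by rewrite !gnorm -(ybE h4) -(commE k) -(ybE h5).
by rewrite !gnorm.
Qed.

Lemma dbl3P : commute l13 l24 -> commute l31 l42 ->
  dbl3 <-> cable_rels c11 a22 a13 b22 b13.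
Proof.
move=> h k; have -> : a22 = l14 * l13 * (l24 * l23) by rewrite !mulgA (commE h).
have -> : b22 = l32 * l42 * (l31 * l41) by rewrite !mulgA -(commE k).
by rewrite /b13 -(mulgA l21); apply: cableP.
Qed.

Lemma dbl1P : dbl1 <-> cable_rels c21 a31 a22 b31 b22.
Proof. by rewrite /a22 -(mulgA (_ * _)) /b31 /b22 -!(mulgA _ l42); apply: cableP. Qed.

Lemma dbl2P : dbl2 <-> cable_rels c12 a31 a13 b31 b13.
Proof.
by rewrite /a31 -(mulgA l14) /a13 -(mulgA l14); apply: cableP.
Qed.

Lemma w2E : dbl1 -> w2 = (l43 * l34)^-1.
Proof.
move=> h; rewrite -(cable_word_full h) /w2 /c21 /b22 /a22 /b31 /a31 /b21 /a21.
by rewrite !mulgA.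
Qed.

(** For the converse, six far commutations are given, two come from the exchange relations, two from
    [a31] and [b31], and two from doubled relations. The other sixteen doubled relations and the two
    on [w2] give the eighteen braid relations that involve strand 4. *)
Lemma wordP : vp4_rels l <-> word_rels /\ stable_rels.
Proof.
split=> [[B C]|].
  have y3 : yb3 l12 l21 l13 l31 l23 l32 by split; [split|split]; apply: B.
  have k1234 : commute l12 l34 by apply: C.
  have k1243 : commute l12 l43 by apply: C.
  have k2134 : commute l21 l34 by apply: C.
  have k2143 : commute l21 l43 by apply: C.
  have k1324 : commute l13 l24 by apply: C.
  have k1342 : commute l13 l42 by apply: C.
  have k3124 : commute l31 l24 by apply: C.
  have k3142 : commute l31 l42 by apply: C.
  have k2314 : commute l23 l14 by apply: C.
  have k2341 : commute l23 l41 by apply: C.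
  have k3214 : commute l32 l14 by apply: C.
  have k3241 : commute l32 l41 by apply: C.
  have [[h1 h2 h3 h4] [h5 h6]] := y3.
  have y1 : dbl3.
    split; [split|split].
    - by apply/(dbl3_a12 k1324 k2314 h1)/B.
    - by apply/(dbl3_a21 k1324 k2314 h2)/B.
    - by apply/(dbl3_b21 k3142 h3 (B 2 1%N 4 isT))/commute_sym.
    - by apply/(dbl3_b12 k3142 k3241 h4)/B.
    - by apply/(dbl3_m12 k1342 h5 (B 4 2 1%N isT))/commute_sym.
    - by apply/(dbl3_m21 k3124 k2341 h6)/B.
  have y2 : dbl1.
    split; [split|split].
    - by apply/(dbl1_a23 k1324 k2314 (B 3 4 1%N isT))/B.
    - by apply/(dbl1_a32 k3124 k3214 (B 1%N 4 3 isT))/B.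
    - by apply/(dbl1_b32 k3142 k3241 (B 3 1%N 4 isT))/B.
    - by apply/(dbl1_b23 k1342 k2341 (B 1%N 3 4 isT))/B.
    - by apply/(dbl1_m23 k1324 k2314 (B 4 3 1%N isT))/B.
    - by apply/(dbl1_m32 k3142 k3241 (B 4 1%N 3 isT))/B.
  have y3' : dbl2.
    split; [split|split].
    - by apply/(dbl2_a13 k1234 k1324 (B 2 4 1%N isT))/B.
    - by apply/(dbl2_a31 k2134 k3124 (B 1%N 4 2 isT))/B.
    - by apply/(dbl2_b21 k2143 k3142 (B 3 1%N 4 isT))/B.
    - by apply/(dbl2_b13 k1243 k1342 (B 1%N 2 4 isT))/B.
    - by apply/(dbl2_m12 k1243 k1342 (B 4 3 1%N isT))/B.
    - by apply/(dbl2_m31 k2134 k3124 (B 4 1%N 2 isT))/B.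
  have c0 := proj1 (cableP _ _ _ _ _ _) y3.
  have c1 := proj1 (dbl3P k1324 k3142) y1.
  have c2 := proj1 dbl1P y2.
  have c3 := proj1 dbl2P y3'.
  have [[_ _ ? ?] _] := c0; have [[_ _ ? ?] _] := c1.
  split; split=> //; split.
  - exact/commute_a31.
  - exact/commute_b31.
  - change (commute a13 w2); rewrite w2E //; apply/commVE.
    by apply/(w2_a13 k1234 k1243 (B 3 4 1%N isT))/B.
  - change (commute b13 w2); rewrite w2E //; apply/commVE.
    by apply/(w2_b13 k2134 k2143 (B 4 1%N 3 isT))/B.
  - by apply/(exchange_a y3 k1324)/commute_sym.
  - by apply/(exchange_b y3 k1342)/commute_sym.
move=> [[[c0 c1 c2 c3] [ca cb] [wa wb] [ea eb]]
  [[k1234 k1243 k1324] [k1342 k2314 k2341]]].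
have y3 : yb3 l12 l21 l13 l31 l23 l32 by apply/cableP.
have k3124 : commute l31 l24 by apply/commute_sym/(exchange_a y3 k1324).
have k3142 : commute l31 l42 by apply/commute_sym/(exchange_b y3 k1342).
have y1 := proj2 (dbl3P k1324 k3142) c1.
have y2 := proj2 dbl1P c2.
have y3' := proj2 dbl2P c3.
have [[_ _ ? ?] _] := c0; have [[_ _ ? ?] _] := c1.
have k2134 : commute l21 l34 by apply/commute_a31.
have k2143 : commute l21 l43 by apply/commute_b31.
change (commute a13 w2) in wa; change (commute b13 w2) in wb.
move: wa wb; rewrite (w2E y2) => /commVE wa /commVE wb.
have [[h1 h2 h3 h4] [h5 h6]] := y3.
case: y1 => -[p1 p2 p3 p4] [p5 p6].
case: y2 => -[q1 q2 q3 q4] [q5 q6].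
case: y3' => -[r1 r2 r3 r4] [r5 r6].
(* The order is dictated by the hypotheses of the equivalences. The relations on [w2] supply [m13y]
   and [b31y], and the latter starts all those of type [yb_b]; [k3214] and [k3241] are the far
   commutations hidden in doubled relations. *)
have a12y := proj1 (dbl3_a12 k1324 k2314 h1) p1.
have a21y := proj1 (dbl3_a21 k1324 k2314 h2) p2.
have a13y := proj1 (dbl2_a13 k1234 k1324 a12y) r1.
have a31y := proj1 (dbl2_a31 k2134 k3124 a21y) r2.
have a23y := proj1 (dbl1_a23 k1324 k2314 a13y) q1.
have m13y := proj1 (w2_a13 k1234 k1243 a13y) wa.
have m12y := proj1 (dbl2_m12 k1243 k1342 m13y) r5.
have /commute_sym k3214 := proj1 (dbl3_m12 k1342 h5 m12y) p5.
have a32y := proj1 (dbl1_a32 k3124 k3214 a31y) q2.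
have m23y := proj1 (dbl1_m23 k1324 k2314 m13y) q5.
have m21y := proj1 (dbl3_m21 k3124 k2341 h6) p6.
have m31y := proj1 (dbl2_m31 k2134 k3124 m21y) r6.
have b31y := proj1 (w2_b13 k2134 k2143 m31y) wb.
have b21y := proj1 (dbl2_b21 k2143 k3142 b31y) r3.
have /commute_sym k3241 := proj1 (dbl3_b21 k3142 h3 b21y) p3.
have b12y := proj1 (dbl3_b12 k3142 k3241 h4) p4.
have b13y := proj1 (dbl2_b13 k1243 k1342 b12y) r4.
have b32y := proj1 (dbl1_b32 k3142 k3241 b31y) q3.
have b23y := proj1 (dbl1_b23 k1342 k2341 b13y) q4.
have m32y := proj1 (dbl1_m32 k3142 k3241 m31y) q6.
split.
  by move=> [|[|[|[|[|?]]]]] [|[|[|[|[|?]]]]] [|[|[|[|[|?]]]]] s; first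
    [by move: s; rewrite /strands /= ?andbF | assumption | apply: yb_sym; assumption].
by move=> [|[|[|[|[|?]]]]] [|[|[|[|[|?]]]]] [|[|[|[|[|?]]]]] [|[|[|[|[|?]]]]] s; first
  [by move: s; rewrite /strands /= ?andbF | assumption | apply: commute_sym; assumption].
Qed.

End FourStrands.

(** * The relations of G_4 *)

Definition respects (X : choiceType) (R : free_group X -> free_group X -> Prop)
    (H : groupType) (f : X -> H) : Prop :=
  forall u v, R u v -> free_lift f u = free_lift f v.

Section Holds.
Variables (X : choiceType) (H : groupType) (f : X -> H).

Definition holds (s : seq (free_group X * free_group X)) : Prop :=
  foldr (fun p Q => free_lift f p.1 = free_lift f p.2 /\ Q) True s.

Lemma holdsP s :
  (forall u v, (u, v) \in s -> free_lift f u = free_lift f v) <-> holds s.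
Proof.
elim: s => [|[u v] s IHs] /=; first by split.
split=> [h|[h /IHs hs] x y]; last by rewrite inE => /predU1P[[-> ->]|/hs].
by split; [apply/h/mem_head|apply/IHs => x y xy; apply: h; rewrite inE xy orbT].
Qed.

Lemma holds_cat s t : holds (s ++ t) <-> holds s /\ holds t.
Proof. by elim: s => [|p s IHs] /=; tauto. Qed.

End Holds.

Section FreeLift.
Variables (X : choiceType) (H : groupType) (f : X -> H).
Implicit Types u v : free_group X.

Lemma free_lift1 : free_lift f 1 = 1. Proof. exact: gmulf1. Qed.
Lemma free_liftV u : free_lift f u^-1 = (free_lift f u)^-1.
Proof. exact: gmulfV. Qed.
Lemma free_liftJ u v : free_lift f (u ^ v) = free_lift f u ^ free_lift f v.
Proof. exact: gmulfJ. Qed.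
Lemma free_liftR u v : free_lift f [~ u, v] = [~ free_lift f u, free_lift f v].
Proof. exact: gmulfR. Qed.

Definition free_liftE :=
  (free_lift1, free_liftV, free_liftJ, free_liftR, free_liftM, free_lift_letter).

End FreeLift.

(** * Cable systems and exchange relations in terms of conjugation *)

Section CableConj.
Variable H : groupType.
Implicit Types a b c g x y : H.

Lemma conj_commute x y : x ^ y = x <-> commute x y.
Proof. by split=> [e|e]; [rewrite /commute conjgC e|rewrite /conjg e mulKg]. Qed.

Lemma commg_commute x y : [~ x, y] = 1 <-> commute x y.
Proof. by split=> [e|/commgP/eqP //]; apply/commgP/eqP. Qed.

Lemma conj_eq_commute x c g : x ^ c = x ^ g <-> commute x (g * c^-1).
Proof.
rewrite -conj_commute conjgM.
by split=> [<-|e]; [rewrite conjgK|rewrite -[in LHS]e conjgKV].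
Qed.

Lemma cable_conj c a a' b b' :
  let g := b' * a' * (b * a)^-1 in
  cable_rels c a a' b b' <->
  [/\ [~ a, a'] = 1, [~ b, b'] = 1, a ^ c = a & b ^ c = b] /\
  (a' ^ c = a' ^ g /\ b' ^ c = b' ^ g).
Proof.
move=> g; move: (commg_commute a a') (commg_commute b b') (conj_commute a c)
  (conj_commute b c) (conj_eq_commute a' c g) (conj_eq_commute b' c g).
by rewrite /cable_rels -/g => ? ? ? ? ? ?; split=> -[[? ? ? ?] [? ?]]; split; split; tauto.
Qed.

(** As [w] commutes with [b' * a'], its inverse has the same shape for [c^-1]. This yields the
    relations with exponent -1. *)
Lemma cable_relsV c a a' b b' : cable_rels c a a' b b' ->
  (b' * a' * (b * a)^-1 * c^-1)^-1 = (b' * a')^-1 * (b * a) * c^-1^-1.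
Proof.
move=> [[_ _ h1 h2] [h3 h4]].
have h5 : commute (b * a) c.
  by apply/commute_sym/commuteM; apply: commute_sym.
have : commute (b' * a' * (b * a)^-1 * c^-1) (b' * a').
  by apply: commuteM; apply: commute_sym.
move: (b' * a') (b * a) h5 => p q h5; rewrite /commute => k.
have {}k : q^-1 * c^-1 * p = p * q^-1 * c^-1.
  by apply: (mulgI p); rewrite !mulgA k !mulgA.
by rewrite -k !invgM !invgK -mulgA h5.
Qed.

Lemma cable_conjV c a a' b b' :
  let g := (b' * a')^-1 * (b * a) in
  cable_rels c a a' b b' ->
  [/\ a ^ c^-1 = a, b ^ c^-1 = b, a' ^ c^-1 = a' ^ g & b' ^ c^-1 = b' ^ g].
Proof.
move=> g h; have e := cable_relsV h; case: h => -[_ _ h1 h2] [h3 h4].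
have V x y : commute x y -> commute x y^-1 by move/commVE.
split; try by apply/conj_commute/V.
- by apply/conj_eq_commute; rewrite /g -e; apply: V.
- by apply/conj_eq_commute; rewrite /g -e; apply: V.
Qed.

Section Exchange.
Variables c d x y : H.
Hypothesis cx : commute x c.

(** For [c = c11], [d = c12], with [x] and [y] the elements [a22] and [a13], or [b22] and [b13], the
    formulas for [x ^ d] and for [x ^ d^-1] amount to the same exchange relation. *)
Lemma exchange_conj_a : commute x y ->
  x ^ d = d^-1 * d ^ c * (y ^ c)^-1 * x * y ^ d <->
  c * (y^-1 * x) * d = d * (y^-1 * x) * c.
Proof.
move=> xy; apply: (@eq_in_context _ (c * d)^-1 (d^-1 * y * d)); rewrite /conjg !gnorm.
  by rewrite (commE xy) !gnorm.
by rewrite (commE cx).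
Qed.

Lemma exchange_conj_b :
  x ^ d = d^-1 * d ^ c * x * (y ^ c)^-1 * y ^ d <->
  c * (x * y^-1) * d = d * (x * y^-1) * c.
Proof.
apply: (@eq_in_context _ (c * d)^-1 (d^-1 * y * d)); rewrite /conjg !gnorm //.
by rewrite -(commE cx) !gnorm.
Qed.

Lemma exchange_conjV_a :
  x ^ d^-1 = y ^ d^-1 * (y ^ c^-1)^-1 * x * (d ^ c^-1 * d^-1) <->
  d * (y^-1 * x) * c = c * (y^-1 * x) * d.
Proof.
apply: (@eq_in_context _ (d * y * d^-1) (c^-1 * d^-1)); rewrite /conjg !gnorm //.
by rewrite (commE cx) !gnorm.
Qed.

Lemma exchange_conjV_b : commute x y ->
  x ^ d^-1 = y ^ d^-1 * x * (y ^ c^-1)^-1 * (d ^ c^-1 * d^-1) <->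
  d * (x * y^-1) * c = c * (x * y^-1) * d.
Proof.
move=> xy; apply: (@eq_in_context _ (d * y * d^-1) (c^-1 * d^-1)); rewrite /conjg !gnorm.
  by rewrite -(commE xy) !gnorm.
by rewrite (commE cx).
Qed.

End Exchange.

End CableConj.

Section G4Relations.
Variables (H : groupType) (f : g4_gen -> H).

(** The relations with exponent 1 give the reduced ones. Those with exponent -1 are recovered
    through [cable_conjV], [cable_relsV] and the two lemmas [exchange_conjV_a] and
    [exchange_conjV_b]. *)
Lemma g4_reduced :
  respects g4_rel f <->
  reduced_rels (f C11) (f A21) (f A12) (f C21 * (f A21)^-1)
    (f C12 * (f A12)^-1) (f A31) (f A22) (f A13) (f B31) (f B22) (f B13).
Proof.
apply: iff_trans (holdsP _ _) _.
rewrite /g4_rels !holds_cat /holds /= !free_liftE /reduced_rels !mulgVK.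
set c11 := f C11; set a21 := f A21; set a12 := f A12; set c21 := f C21.
set c12 := f C12; set a31 := f A31; set a22 := f A22; set a13 := f A13.
set b31 := f B31; set b22 := f B22; set b13 := f B13.
set b21 := c21 / a21; set b12 := c12 / a12.
have b21K : b21 * a21 = c21 by rewrite mulgVK.
have b12K : b12 * a12 = c12 by rewrite mulgVK.
(* As [c11] conjugates [c12] like [c21^-1], the commutators in the relations for [a22] and [b22] can
   be rewritten with [c11], the form that the exchange lemmas use. *)
have c12R c : c12 ^ c = c12 ^ c21^-1 -> [~ c12, c21^-1] = c12^-1 * c12 ^ c.
  by move=> ->.
have c12RV c : c12 ^ c = c12 ^ c21 -> [~ c21, c12^-1] = c12 ^ c * c12^-1.
  by move=> ->; rewrite /commg /conjg !gnorm.
split.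
  move=> [[[p1 [p2 [p3 [p4 [p5 [p6 [p7 [p8 [p9 [p10 _]]]]]]]]]]
    [[p11 [p12 [p13 [p14 [p15 [p16 _]]]]]] [p17 [p18 [p19 [p20 _]]]]]]
    [_ [[_ [ka [_ [kb _]]]] [q1 [q2 [q3 [q4 [q5 [q6 [q7 [q8 _]]]]]]]]]]].
  split; split.
  - apply/cable_conj; rewrite b21K b12K; do 2!split => //.
      by rewrite /b21 conjMg conjVg p1 p3.
    by rewrite /b12 !conjMg !conjVg p2 p4 (conjgM c12 c12) [c12 ^ c12]mulKg.
  - by apply/cable_conj.
  - by apply/cable_conj.
  - by apply/cable_conj.
  - exact/conj_commute.
  - exact/conj_commute.
  - exact/conj_eq_commute.
  - exact/conj_eq_commute.
  - apply/exchange_conj_a; [exact/conj_commute|exact/commg_commute|].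
    by rewrite -(c12R _ p4) p7 p18.
  - apply/exchange_conj_b; first exact/conj_commute.
    by rewrite -(c12R _ p4) p10 p20.
move=> [[d0 d1 d2 d3] [e1 e2] [w1 w2] [g1 g2]].
have [[q1 q5 p1 pb21] [p2 pb12]] := proj1 (cable_conj _ _ _ _ _) d0.
have [[q4 q8 p6 p9] [p7 p10]] := proj1 (cable_conj _ _ _ _ _) d1.
have [[q2 q6 p11 p14] [p12 p15]] := proj1 (cable_conj _ _ _ _ _) d2.
have [[q3 q7 p17 p19] [p18 p20]] := proj1 (cable_conj _ _ _ _ _) d3.
have [n1 nb21 n2 nb12] := cable_conjV d0.
have [n6 n9 n7 n10] := cable_conjV d1.
have [n11 n14 n12 n15] := cable_conjV d2.
have [n17 n19 n18 n20] := cable_conjV d3.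
move: p2 pb12 n2 nb12; rewrite b21K b12K => p2 pb12 n2 nb12.
have p3 : c21 ^ c11 = c21 by rewrite -b21K conjMg pb21 p1.
have n3 : c21 ^ c11^-1 = c21 by rewrite -b21K conjMg nb21 n1.
have p4 : c12 ^ c11 = c12 ^ c21^-1.
  by rewrite -{1}b12K conjMg pb12 p2 -conjMg b12K conjgM [c12 ^ c12]mulKg.
have n4 : c12 ^ c11^-1 = c12 ^ c21.
  rewrite -{1}b12K conjMg nb12 n2 -conjMg b12K conjgM; congr (_ ^ _).
  by rewrite /conjg mulgV mulg1 invgK.
have p13 := proj2 (conj_eq_commute _ _ _) w1.
have p16 := proj2 (conj_eq_commute _ _ _) w2.
move: w1 w2 => /commVE + /commVE; rewrite (cable_relsV d2).
move=> /conj_eq_commute n13 /conj_eq_commute n16.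
have ca := proj1 (conj_commute _ _) p6.
have cb := proj1 (conj_commute _ _) p9.
have cya := proj1 (commg_commute _ _) q4.
have cyb := proj1 (commg_commute _ _) q8.
have ka := proj2 (exchange_conj_a c12 ca cya) g1.
have kb := proj2 (exchange_conj_b c12 b13 cb) g2.
have ma := proj2 (exchange_conjV_a c12 a13 ca) (esym g1).
have mb := proj2 (exchange_conjV_b c12 cb cyb) (esym g2).
move: ka kb ma mb; rewrite -(c12R _ p4) -(c12RV _ n4).
rewrite p7 p10 p18 p20 n7 n10 n18 n20 => ka kb ma mb.
by do ?apply: conj => //; apply/conj_commute=> //; apply/commVE.
Qed.

End G4Relations.

(** * Morphisms from presented groups *)

Section Subgroups.
Variable G : groupType.
Implicit Types (S H : set G) (x y : G).

Lemma gen_subgroup_subgroup S : subgroup (gen_subgroup S).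
Proof.
apply/subgroupP; split=> [H [/subgroupP[H1 _] _] //|x y Sx Sy H HS].
by have [/subgroupP[_ HB] _] := HS; apply: HB; [apply: Sx|apply: Sy].
Qed.

Lemma sub_gen_subgroup S : S `<=` gen_subgroup S.
Proof. exact: sub_gen_smallest. Qed.

Lemma gen_subgroup_min S H : subgroup H -> S `<=` H -> gen_subgroup S `<=` H.
Proof. by move=> sH SH x; apply; split. Qed.

Lemma subgroup1 H : subgroup H -> H 1.
Proof. by case/subgroupP. Qed.

Lemma subgroupV H x : subgroup H -> H x -> H x^-1.
Proof. by case/subgroupP=> H1 HB Hx; rewrite -[_^-1]mul1g; apply: HB. Qed.

Lemma subgroupM H x y : subgroup H -> H x -> H y -> H (x * y).
Proof.
move=> sH Hx Hy; rewrite -[y]invgK; case/subgroupP: (sH) => _; apply=> //.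
exact: subgroupV.
Qed.

End Subgroups.

Section Morphisms.

Lemma free_lift_comp (X : choiceType) (G H : groupType)
    (h : UMagmaMorphism.type G H) (f : X -> G) u :
  h (free_lift f u) = free_lift (h \o f) u.
Proof.
rewrite /free_lift; elim: (free_repr u) => [|[x b] s IHs] /=; first exact: gmulf1.
by rewrite gmulfM IHs; case: b; rewrite //= gmulfV.
Qed.

Lemma eq_free_lift (X : choiceType) (G : groupType) (f g : X -> G) :
  f =1 g -> free_lift f =1 free_lift g.
Proof. by move=> /funext ->. Qed.

Lemma free_liftK (X : choiceType) (u : free_group X) : free_lift (@letter X) u = u.
Proof.
rewrite -[in RHS](free_reprK u) /free_lift.
elim: (free_repr u) => [|[x b] s IHs] //=; rewrite IHs.
have -> : (x, b) :: s = [:: (x, b)] ++ s by [].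
rewrite -free_mul_pi; congr (_ * _); case: b => //; exact: free_inv_pi.
Qed.

Lemma range_free_lift (X : choiceType) (G : groupType) (f : X -> G) :
  range (free_lift f) = gen_subgroup (range f).
Proof.
apply/seteqP; split=> [_ [u _ <-]|].
  have sG := @gen_subgroup_subgroup _ (range f).
  rewrite /free_lift; elim: (free_repr u) => [|[x b] s IHs] /=.
    exact: (subgroup1 sG).
  have fx : gen_subgroup (range f) (f x) by apply: sub_gen_subgroup; exists x.
  by apply: (subgroupM sG) => //; case: b => //; apply: (subgroupV sG).
apply: gen_subgroup_min => [|_ [x _ <-]]; last first.
  by exists (letter x); rewrite // free_lift_letter.
apply/subgroupP; split=> [|_ _ [u _ <-] [v _ <-]]; first by exists 1; rewrite ?free_lift1.
by exists (u * v^-1); rewrite // free_liftM free_liftV.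
Qed.

End Morphisms.

Section PresentedLift.
Variables (X : choiceType) (R : free_group X -> free_group X -> Prop).

Lemma respects_closure (H : groupType) (f : X -> H) :
  respects R f -> normal_closure (relators R) `<=` [set u | free_lift f u = 1].
Proof.
move=> Rf u; apply; split; last first.
  by move=> _ [a [b [ab ->]]] /=; rewrite free_liftM free_liftV (Rf _ _ ab) mulgV.
split; last by move=> x y /= fx; rewrite free_liftJ fx conj1g.
apply/subgroupP; split=> [|x y /= fx fy]; first by rewrite /= free_lift1.
by rewrite free_liftM free_liftV fx fy invg1 mulg1.
Qed.

Lemma respects_pres_gen : respects R (@pres_gen _ R).
Proof.
move=> u v uv; rewrite !pres_lift; apply/pres_eqP; apply: sub_normal_closure.
by exists u, v.
Qed.

Lemma pres_rec (H : groupType) (f : X -> H) : respects R f ->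
  exists h : UMagmaMorphism.type (presented_group R) H,
    forall u, h (pres_pi R u) = free_lift f u.
Proof.
move=> Rf; pose h (x : presented_group R) := free_lift f (pres_repr x).
have hE u : h (pres_pi R u) = free_lift f u.
  have := respects_closure Rf (pres_reprP (R := R) u).
  by rewrite /= free_liftM free_liftV => /divg1_eq.
have hM : monoid_morphism h.
  split; first exact: etrans (hE 1) (free_lift1 _).
  by move=> x y; rewrite -[x]pres_reprK -[y]pres_reprK [_ * _]pres_mul_pi !hE free_liftM.
pose m := isUMagmaMorphism.Build _ _ h hM.
by exists (HB.pack_for (UMagmaMorphism.type (presented_group R) H) h m).
Qed.

Lemma presentsI (G : groupType) (H : set G) (f : X -> G) :
  range (free_lift f) = H -> respects R f ->
  (forall u, free_lift f u = 1 -> pres_pi R u = 1) -> presents R H f.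
Proof.
move=> fH Rf inj; split=> //; apply/seteqP; split; last exact: respects_closure.
by move=> u /inj /pres_eqP; rewrite invg1 mulg1.
Qed.

End PresentedLift.

(** * The universal property of VP_4 *)

Section VP4Lift.

Lemma free_lift_lam (H : groupType) (l : nat -> nat -> H) i j :
  strands 4 [:: i; j] ->
  free_lift (fun p : vgen 4 => l (val p).1 (val p).2) (free_lam 4 i j) = l i j.
Proof.
rewrite /strands /= inE andbT /free_lam => /and3P[ij ilt jlt].
by rewrite insubT /= ?ilt ?(proj1 (andP jlt)) // => p; rewrite free_lift_letter.
Qed.

Lemma VP4_rec (H : groupType) (l : nat -> nat -> H) : vp4_rels l ->
  exists h : UMagmaMorphism.type VP4 H,
    forall i j, strands 4 [:: i; j] -> h (lam 4 i j) = l i j.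
Proof.
move=> [yb_l comm_l]; pose f (p : vgen 4) := l (val p).1 (val p).2.
have fE i j (s : seq nat) : strands 4 s -> i != j -> i \in s -> j \in s ->
    free_lift f (free_lam 4 i j) = l i j.
  move=> /andP[_ /allP s4] ij /s4 si /s4 sj; apply: free_lift_lam.
  by rewrite /strands /= inE ij si sj.
have Rf : respects (@VP_rel 4) f.
  move=> _ _ [i j k m s|i j k s]; rewrite !free_liftM.
    rewrite !(fE _ _ _ s) ?inE ?eqxx ?orbT //; first exact: comm_l s.
      by case/andP: s; rewrite /= !inE; do ?case: (_ == _).
    by case/andP: s; rewrite /= !inE; do ?case: (_ == _).
  rewrite !(fE _ _ _ s) ?inE ?eqxx ?orbT //; first exact: yb_l s.
  - by case/andP: s; rewrite /= !inE; do ?case: (_ == _).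
  - by case/andP: s => u _; rewrite eq_sym; move: u; rewrite /= !inE; do ?case: (_ == _).
  - by case/andP: s => u _; rewrite eq_sym; move: u; rewrite /= !inE; do ?case: (_ == _).
have [h hE] := pres_rec Rf; exists h => i j ij.
by rewrite /lam pres_lift hE free_lift_lam.
Qed.

Lemma vp4_rels_lam : vp4_rels (lam 4).
Proof. by split=> [i j k /lam_braid|i j k m /lam_comm]. Qed.

End VP4Lift.

(** * Words in the generators of VP_4, and solving for these generators *)

Section Words.
Variables (H : groupType) (l : nat -> nat -> H).

Definition g4_word (g : g4_gen) : H :=
  match g with
  | C11 => l 2 1 * l 1 2
  | A21 => l 1 3 * l 2 3
  | A12 => l 1 3 * l 1 2
  | C21 => l 3 2 * l 3 1 * (l 1 3 * l 2 3)
  | C12 => l 2 1 * l 3 1 * (l 1 3 * l 1 2)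
  | A31 => l 1 4 * l 2 4 * l 3 4
  | A22 => l 1 4 * l 2 4 * l 1 3 * l 2 3
  | A13 => l 1 4 * l 1 3 * l 1 2
  | B31 => l 4 3 * l 4 2 * l 4 1
  | B22 => l 3 2 * l 3 1 * l 4 2 * l 4 1
  | B13 => l 2 1 * l 3 1 * l 4 1
  end.

Lemma vp4_g4 : vp4_rels l <-> respects g4_rel g4_word /\ stable_rels l.
Proof.
apply: iff_trans (wordP l) _; have := g4_reduced g4_word.
by rewrite /g4_word -/(g4_word _) /= !mulgK /word_rels => ->.
Qed.

End Words.

Lemma g4_val_word : g4_val =1 g4_word (lam 4).
Proof. by case. Qed.

Section BaseWords.

Local Notation g := letter.

Definition A_words : seq (free_group g4_gen) :=
  let b21 := g C21 * (g A21)^-1 in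
  let b12 := g C12 * (g A12)^-1 in
  [:: g A21 * (g A22)^-1 * g A31;
      g A12 * (g A13)^-1 * g A22 * (g A21)^-1;
      g A13 * (g A12)^-1;
      g B31 * (g B22)^-1 * b21;
      b21^-1 * g B22 * (g B13)^-1 * b12;
      b12^-1 * g B13].

Definition B_words : seq (free_group g4_gen) :=
  [:: A_words`_0; A_words`_1 ^ g A12; A_words`_2 ^ ((g A21)^-1 * g A12);
      A_words`_3; A_words`_4 ^ g A12; A_words`_5 ^ ((g A21)^-1 * g A12)].

End BaseWords.

Lemma A_words_val : map (free_lift g4_val) A_words = Elements.A_gens.
Proof. by rewrite /= !free_liftE /= /Elements.c21 /Elements.c12 !mulgK. Qed.

Lemma B_words_val : map (free_lift g4_val) B_words = Elements.B_gens.
Proof. by rewrite /= !free_liftE /= /Elements.c21 /Elements.c12 !mulgK. Qed.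

Section StableLetter.
Variables (H : groupType) (l : nat -> nat -> H).

Lemma A_words_lam :
  map (free_lift (g4_word l)) A_words = [:: l 3 4; l 2 4; l 1 4; l 4 3; l 4 2; l 4 1].
Proof. by rewrite /= !free_liftE /= !gnorm. Qed.

(** Comparing conjugation by [l12] with conjugation by [1], by [a12 = l13 * l12] or by
    [a21^-1 * a12 = l23^-1 * l12] gives commutation with [l12], [l13] or [l23] respectively. *)
Lemma stable_words : stable_rels l <->
  [seq free_lift (g4_word l) w ^ l 1 2 | w <- A_words]
    = map (free_lift (g4_word l)) B_words.
Proof.
have [e1 e2 e3 e4 e5 e6] := A_words_lam.
have -> : [seq free_lift (g4_word l) w ^ l 1 2 | w <- A_words] =
  [seq x ^ l 1 2 | x <- [:: l 3 4; l 2 4; l 1 4; l 4 3; l 4 2; l 4 1]].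
  by rewrite -A_words_lam -map_comp.
rewrite /B_words [map _ [:: _; _; _; _; _; _] in RHS]/= !free_liftJ.
rewrite e1 e2 e3 e4 e5 e6 !free_liftE /=.
have h1 x : commute (l 1 2) x <-> x ^ l 1 2 = x.
  by rewrite conj_commute; split=> /commute_sym.
have h2 x : commute (l 1 3) x <-> x ^ l 1 2 = x ^ (l 1 3 * l 1 2).
  rewrite conjgM; split=> [/commute_sym/conj_commute -> //|/conjg_inj/esym].
  by move/conj_commute/commute_sym.
have h3 x : commute (l 2 3) x <->
    x ^ l 1 2 = x ^ ((l 1 3 * l 2 3)^-1 * (l 1 3 * l 1 2)).
  have -> : (l 1 3 * l 2 3)^-1 * (l 1 3 * l 1 2) = (l 2 3)^-1 * l 1 2.
    by rewrite !gnorm.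
  rewrite conjgM; split=> [/commute_sym/commVE/conj_commute -> //|/conjg_inj/esym].
  by move/conj_commute/commVE/commute_sym.
split=> [[[/h1-> /h1-> /h2->] [/h2-> /h3-> /h3->]] //|[? ? ? ? ? ?]].
by split; split; (apply/h1 || apply/h2 || apply/h3).
Qed.

(* The words of [g4_word] and of [A_words] solved for the l_ij. *)
Definition hnn_lam (f : g4_gen -> H) (t : H) (i j : nat) : H :=
  match i, j with
  | 1, 2 => t
  | 2, 1 => f C11 * t^-1
  | 1, 3 => f A12 * t^-1
  | 2, 3 => t * (f A12)^-1 * f A21
  | 3, 1 => t * (f C11)^-1 * f C12 * (f A12)^-1
  | 3, 2 => f C21 * (f A21)^-1 * f A12 * (f C12)^-1 * f C11 * t^-1
  | 3, 4 => free_lift f A_words`_0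
  | 2, 4 => free_lift f A_words`_1
  | 1, 4 => free_lift f A_words`_2
  | 4, 3 => free_lift f A_words`_3
  | 4, 2 => free_lift f A_words`_4
  | 4, 1 => free_lift f A_words`_5
  | _, _ => 1
  end.

Lemma hnn_lam_word f t : g4_word (hnn_lam f t) =1 f.
Proof. by case; rewrite /= ?free_liftE !gnorm. Qed.

End StableLetter.

(** The universal property of an HNN-extension, for VP_4: the family [hnn_lam f t] has [f] as its
    words, so [vp4_g4] shows that it satisfies the relations of VP_4. *)
Lemma VP4_hnn_rec (H : groupType) (f : g4_gen -> H) (t : H) :
  respects g4_rel f ->
  [seq free_lift f w ^ t | w <- A_words] = map (free_lift f) B_words ->
  exists h : UMagmaMorphism.type VP4 H, h Elements.a11 = t /\ h \o g4_val =1 f.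
Proof.
move=> Rf ft; have fE : g4_word (hnn_lam f t) = f by apply/funext/hnn_lam_word.
have [|h hE] := @VP4_rec _ (hnn_lam f t).
  by apply/vp4_g4; split; [|apply/stable_words]; rewrite fE.
exists h; split=> [|x]; first exact: hE.
rewrite /= -(hnn_lam_word f t) g4_val_word; move: (hnn_lam f t) hE => l hE.
by case: x; rewrite /= !gmulfM !hE.
Qed.

Lemma g4_val_respects : respects g4_rel g4_val.
Proof. by rewrite (funext g4_val_word); have [] := proj1 (vp4_g4 _) (vp4_rels_lam). Qed.

Lemma A_gens_conj :
  [seq x ^ Elements.a11 | x <- Elements.A_gens] = Elements.B_gens.
Proof.
have [_ /stable_words] := proj1 (vp4_g4 _) vp4_rels_lam.
by rewrite -(funext g4_val_word) B_words_val -A_words_val -map_comp; apply.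
Qed.

(** * Adding a stable letter *)

Section Bijections.
Variable T : Type.

Record bijection := Bijection {
  bij_fun :> T -> T;
  bij_inv : T -> T;
  bij_funK : cancel bij_fun bij_inv;
  bij_invK : cancel bij_inv bij_fun }.

HB.instance Definition _ := gen_eqMixin bijection.
HB.instance Definition _ := gen_choiceMixin bijection.

Lemma bijection_ext (p q : bijection) : p =1 q -> p = q.
Proof.
case: p q => p p' pK p'K [q q' qK q'K] /= /funext pq; subst q.
have e : p' = q' by apply/funext => x; rewrite -{1}(q'K x) pK.
by subst q'; congr Bijection; apply: Prop_irrelevance.
Qed.

(* Products act on the right: [p * q] applies [p] first. *)
Definition bij_mul (p q : bijection) : bijection :=
  Bijection (can_comp (bij_funK q) (bij_funK p)) (can_comp (bij_invK p) (bij_invK q)).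
Definition bij_one : bijection := @Bijection id id (fun=> erefl) (fun=> erefl).
Definition bij_opp (p : bijection) : bijection := Bijection (bij_invK p) (bij_funK p).

Fact bij_mulA : associative bij_mul. Proof. by move=> p q r; apply: bijection_ext. Qed.
Fact bij_mul1 : left_id bij_one bij_mul. Proof. by move=> p; apply: bijection_ext. Qed.
Fact bij_mulr1 : right_id bij_one bij_mul. Proof. by move=> p; apply: bijection_ext. Qed.
Fact bij_mulV : left_inverse bij_one bij_opp bij_mul.
Proof. by move=> p; apply: bijection_ext => x /=; rewrite bij_invK. Qed.
Fact bij_mulrV : right_inverse bij_one bij_opp bij_mul.
Proof. by move=> p; apply: bijection_ext => x /=; rewrite bij_funK. Qed.

HB.instance Definition _ := isGroup.Build bijection
  bij_mulA bij_mul1 bij_mulr1 bij_mulV bij_mulrV.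

Lemma bij_mulE (p q : bijection) x : (p * q) x = q (p x).
Proof. by []. Qed.

End Bijections.

Section Transversal.
Variables (F G : groupType) (h : UMagmaMorphism.type F G).
Hypothesis h_inj : injective h.

(* [r i] is the representative of the left coset [i] of the image of [h]. *)
Lemma transversal : exists (Q : Type) (r : Q -> G) (q : G -> Q) (w : G -> F),
  [/\ forall x, r (q x) * h (w x) = x, forall i y, q (r i * h y) = i &
      forall i y, w (r i * h y) = y].
Proof.
have ex x : exists y, [set z | exists a, x = z * h a] y.
  by exists x, 1; rewrite gmulf1 mulg1.
(* The set contains [x], so a true representative is chosen; the choice depends only on the set,
   hence only on the coset. *)
pose rep (x : G) : G := xget 1 [set z | exists a, x = z * h a].
have repP x : exists a, x = rep x * h a := xgetPex 1 (ex x).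
have repE x a : rep (x * h a) = rep x.
  rewrite /rep; congr xget; apply/seteqP; split=> z /= [b e].
    by exists (b * a^-1); rewrite gmulfM gmulfV mulgA -e mulgK.
  by exists (b * a); rewrite gmulfM mulgA -e.
have rep_rep x : rep (rep x) = rep x.
  by have [a e] := repP x; rewrite [in RHS]e repE.
have [w wP] := choice repP.
pose q x : {i : G | rep i = i} := exist _ (rep x) (rep_rep x).
exists {i : G | rep i = i}, (@sval _ _), q, w.
have sv (i : {i : G | rep i = i}) y : rep (sval i * h y) = sval i.
  by rewrite repE (svalP i).
split=> [x|i y|i y]; first by rewrite /= -wP.
  by case: i => i ii; apply: eq_exist; apply: (sv (exist _ i ii)).
apply: h_inj; apply: (mulgI (rep (sval i * h y))).
by rewrite -wP sv.
Qed.

End Transversal.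

Section HNNAction.
Variables (F G : groupType) (al be : UMagmaMorphism.type F G).
Hypotheses (al_inj : injective al) (be_inj : injective be).

Definition scons T (x : T) (s : nat -> T) (n : nat) : T := if n is m.+1 then s m else x.
Definition stail T (s : nat -> T) (n : nat) : T := s n.+1.

Lemma sconsK T (x : T) s : stail (scons x s) = s. Proof. by []. Qed.
Lemma stailK T (s : nat -> T) : scons (s 0) (stail s) = s.
Proof. by apply/funext; case. Qed.

(* The regular action of [G] is enlarged by two stacks, holding the names of the
   cosets met so far, so that the bijection [t] turning the action of [F] via
   [al] into its action via [be] is explicit, whatever the indices of the two
   images. *)
Lemma hnn_action : exists (S : Type) (rho : UMagmaMorphism.type G (bijection S))
    (t : bijection S), injective rho /\ forall w, rho (al w) ^ t = rho (be w).
Proof.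
have [Qa [ra [qa [wa [raK qaK waK]]]]] := transversal al_inj.
have [Qb [rb [qb [wb [rbK qbK wbK]]]]] := transversal be_inj.
pose S : Type := G * (nat -> Qa) * (nat -> Qb).
pose R x : bijection S := @Bijection S
  (fun s => (s.1.1 * x, s.1.2, s.2)) (fun s => (s.1.1 * x^-1, s.1.2, s.2))
  (fun s => ltac:(by case: s => -[g a b]; rewrite /= mulgK))
  (fun s => ltac:(by case: s => -[g a b]; rewrite /= mulgVK)).
have RM : monoid_morphism R.
  split=> [|x y]; apply: bijection_ext => -[[g a] b] /=; first by rewrite mulg1.
  by rewrite mulgA.
pose m := isUMagmaMorphism.Build _ _ R RM.
pose rho := HB.pack_for (UMagmaMorphism.type G (bijection S)) R m.
(* The group component is split as [ra i * al f]. Then [t] pushes [i] on the first stack, pops some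
   [j] from the second and moves to [rb j * be f]. *)
pose t := @Bijection S
  (fun s => (rb (s.2 0) * be (wa s.1.1), scons (qa s.1.1) s.1.2, stail s.2))
  (fun s => (ra (s.1.2 0) * al (wb s.1.1), stail s.1.2, scons (qb s.1.1) s.2))
  (fun s => ltac:(by case: s => -[g a b]; rewrite /= wbK qbK raK sconsK stailK))
  (fun s => ltac:(by case: s => -[g a b]; rewrite /= waK qaK rbK sconsK stailK)).
exists S, rho, t; split=> [x y e|w].
  have := congr1 (fun p : bijection S => (p (1, fun=> qa 1, fun=> qb 1)).1.1) e.
  by rewrite /= !mul1g.
suff e : rho (al w) * t = t * rho (be w) by rewrite conjgE e mulKg.
apply: bijection_ext => -[[g a] b]; rewrite !bij_mulE /=.
have -> : g * al w = ra (qa g) * al (wa g * w) by rewrite gmulfM mulgA raK.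
by rewrite qaK waK gmulfM mulgA.
Qed.

End HNNAction.

(** * A free subgroup of rank six *)

Section FreeReduction.
Variable X : choiceType.

(** Free reduction as a program: by [reduce_eq], identities between concrete words can be settled by
    [vm_compute]. *)
Definition reduce : word X -> word X :=
  foldr (fun l s => if s is m :: s' then
    if (m.1 == l.1) && (m.2 == ~~ l.2) then s' else l :: s else [:: l]) [::].

Lemma reduceP s : word_eq s (reduce s).
Proof.
elim: s => [|[x b] s IHs] /=; first exact: word_eq_refl.
have e : word_eq ((x, b) :: s) ((x, b) :: reduce s).
  exact: (@word_eq_cat _ [:: _] [:: _] _ _ (word_eq_refl _) IHs).
case: (reduce s) e => [|[y c] s'] //= e.
case: andP => // -[/eqP /= yx /eqP /= cb]; subst y c.
apply: word_eq_trans e _.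
exact: (@word_eq_cat _ [:: _; _] [::] s' s' (word_eq_cancel x b) (word_eq_refl _)).
Qed.

Lemma reduce_eq s t : reduce s = reduce t -> free_pi s = free_pi t.
Proof.
move=> e; apply/word_eq_mod; apply: word_eq_trans (reduceP s) _.
by rewrite e; apply/word_eq_sym/reduceP.
Qed.

Definition subst (f : X -> word X) (s : word X) : word X :=
  flatten [seq if l.2 then word_inv (f l.1) else f l.1 | l <- s].

Definition endo (f : X -> word X) : free_group X -> free_group X :=
  free_lift (fun x => free_pi (f x)).

Lemma endo_pi f s : endo f (free_pi s) = free_pi (subst f s).
Proof.
rewrite /endo free_lift_pi; elim: s => [|[x b] s IHs] //=.
rewrite IHs /subst /= -[in RHS]free_mul_pi; congr (_ * _).
by case: b => //; rewrite -[_^-1]/(free_inv _) free_inv_pi.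
Qed.

Lemma endoM f u v : endo f (u * v) = endo f u * endo f v.
Proof. exact: free_liftM. Qed.

Lemma endo_id f : (forall x, reduce (f x) = reduce [:: (x, false)]) -> endo f =1 id.
Proof.
move=> h u; rewrite -[RHS]free_liftK; apply: eq_free_lift => x; exact: reduce_eq.
Qed.

Lemma endo_comp f g u : endo g (endo f u) = endo (fun x => subst g (f x)) u.
Proof.
rewrite {1}/endo free_lift_comp; apply: eq_free_lift => x /=; exact: endo_pi.
Qed.

Lemma eq_endo f g : (forall x, reduce (f x) = reduce (g x)) -> endo f =1 endo g.
Proof. by move=> h; apply: eq_free_lift => x; apply: reduce_eq. Qed.

End FreeReduction.

Section Model.

(* [(true, i)] and [(false, i)] are the generators x_i and y_i. *)
Definition gen6 : Type := (bool * 'I_3)%type.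

Notation x_ i := ((true, i), false) (only parsing).
Notation y_ i := ((false, i), false) (only parsing).
Notation xV i := ((true, i), true) (only parsing).
Notation yV i := ((false, i), true) (only parsing).

(* The values of this automorphism are forced by the relations of VP_4 between
   l_ij, l_i4, l_4i, l_j4 and l_4j once it is decided that it fixes y_j; it is
   made trivial for [i = j] so as to be always invertible. *)
Definition act (i j : 'I_3) (p : gen6) : word gen6 :=
  if i == j then [:: (p, false)] else
  if p.2 == j then
    if p.1 then [:: x_ i; x_ j; y_ j; xV i; yV j] else [:: y_ j]
  else if p.2 == i then [:: y_ j; (p, false); yV j] else [:: (p, false)].

Definition actV (i j : 'I_3) (p : gen6) : word gen6 :=
  if i == j then [:: (p, false)] else
  if p.2 == j then
    if p.1 then [:: yV j; xV i; y_ j; x_ j; x_ i] else [:: y_ j]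
  else if p.2 == i then [:: yV j; (p, false); y_ j] else [:: (p, false)].

Lemma actK i j : cancel (endo (act i j)) (endo (actV i j)).
Proof.
move=> u; rewrite endo_comp endo_id // => -[b k].
by case: i j k b => [[|[|[|//]]] ?] [[|[|[|//]]] ?] [[|[|[|//]]] ?] [];
  apply/eqP; vm_compute.
Qed.

Lemma actVK i j : cancel (endo (actV i j)) (endo (act i j)).
Proof.
move=> u; rewrite endo_comp endo_id // => -[b k].
by case: i j k b => [[|[|[|//]]] ?] [[|[|[|//]]] ?] [[|[|[|//]]] ?] [];
  apply/eqP; vm_compute.
Qed.

Definition act_bij i j : bijection (free_group gen6) :=
  Bijection (actK i j) (actVK i j).

Definition shift (u : free_group gen6) : bijection (free_group gen6) :=
  Bijection (mulgK u) (mulgVK u).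

Fact shift_morph : monoid_morphism shift.
Proof.
by split=> [|u v]; apply: bijection_ext => w; rewrite ?bij_mulE /= ?mulg1 ?mulgA.
Qed.

HB.instance Definition _ := isUMagmaMorphism.Build _ _ shift shift_morph.

Lemma shift_inj : injective shift.
Proof. by move=> u v /(congr1 (fun p : bijection _ => p 1)) /=; rewrite !mul1g. Qed.

(** Automorphisms normalise the translations. Moving them to the left reduces a relation of VP_4 to
    an identity between words. *)
Lemma shift_act i j u : shift u * act_bij i j = act_bij i j * shift (endo (act i j) u).
Proof. by apply: bijection_ext => v; rewrite !bij_mulE /= endoM. Qed.

Lemma act_shift_yb i j (i_neq_j : i != j) :
  let x k := shift (free_pi [:: x_ k]) in
  let y k := shift (free_pi [:: y_ k]) in
  [/\ yb (act_bij i j) (x i) (x j), yb (y i) (y j) (act_bij i j) &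
      yb (x i) (act_bij i j) (y j)].
Proof.
have eq_shift s t : reduce s = reduce t -> shift (free_pi s) = shift (free_pi t).
  by move/reduce_eq ->.
have shiftM s t : shift (free_pi s) * shift (free_pi t) = shift (free_pi (s ++ t)).
  by rewrite -gmulfM -free_mul_pi.
have shift_actE s : shift (free_pi s) * act_bij i j =
    act_bij i j * shift (free_pi (subst (act i j) s)) by rewrite shift_act endo_pi.
move=> x y; rewrite /x /y /yb; split.
- rewrite -[LHS]mulgA !shiftM shift_actE; congr (_ * _); apply: eq_shift.
  move: i_neq_j => {x y shift_actE}.
  by case: i j => [[|[|[|//]]] ?] [[|[|[|//]]] ?] // _; apply/eqP; vm_compute.
- rewrite -[RHS]mulgA !shiftM shift_actE; congr (_ * _); apply: eq_shift.
  move: i_neq_j => {x y shift_actE}.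
  by case: i j => [[|[|[|//]]] ?] [[|[|[|//]]] ?] // _; apply/eqP; vm_compute.
- rewrite !shift_actE -!mulgA !shiftM; congr (_ * _); apply: eq_shift.
  move: i_neq_j => {x y shift_actE}.
  by case: i j => [[|[|[|//]]] ?] [[|[|[|//]]] ?] // _; apply/eqP; vm_compute.
Qed.

Lemma act_shift_commute i j k b : k != i -> k != j ->
  commute (act_bij i j) (shift (free_pi [:: ((b, k), false)])).
Proof.
move=> ki kj; rewrite /commute shift_act endo_pi /subst /= /act /= (negPf ki) (negPf kj).
by rewrite if_same.
Qed.

Lemma act_yb i j k : [&& i != j, j != k & i != k] ->
  yb (act_bij k i) (act_bij k j) (act_bij i j).
Proof.
move=> ijk; apply: bijection_ext => u; rewrite !bij_mulE /= !endo_comp.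
apply: eq_endo => -[b l]; move: i j k ijk.
move=> [[|[|[|//]]] ?] [[|[|[|//]]] ?] [[|[|[|//]]] ?] // _.
all: by case: l b => [[|[|[|//]]] ?] []; apply/eqP; vm_compute.
Qed.

(* Strands 1, 2 and 3 are numbered modulo 3, so that the third one is [0]. *)
Definition strand (i : nat) : 'I_3 := Ordinal (ltn_pmod i (isT : 0 < 3)).

Definition model (i j : nat) : bijection (free_group gen6) :=
  if i == 4 then shift (free_pi [:: y_ (strand j)])
  else if j == 4 then shift (free_pi [:: x_ (strand i)])
  else act_bij (strand i) (strand j).

Lemma vp4_rels_model : vp4_rels model.
Proof.
split.
  move=> [|[|[|[|[|?]]]]] [|[|[|[|[|?]]]]] [|[|[|[|[|?]]]]] s; first
    [by move: s; rewrite /strands /= ?andbF | exact: act_yb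
    |by have [] := @act_shift_yb (strand 1) (strand 2) isT
    |by have [] := @act_shift_yb (strand 2) (strand 1) isT
    |by have [] := @act_shift_yb (strand 1) (strand 3) isT
    |by have [] := @act_shift_yb (strand 3) (strand 1) isT
    |by have [] := @act_shift_yb (strand 2) (strand 3) isT
    |by have [] := @act_shift_yb (strand 3) (strand 2) isT].
by move=> [|[|[|[|[|?]]]]] [|[|[|[|[|?]]]]] [|[|[|[|[|?]]]]] [|[|[|[|[|?]]]]] s; first
  [by move: s; rewrite /strands /= ?andbF | exact: act_shift_commute
  |by apply/commute_sym; apply: act_shift_commute].
Qed.

End Model.

(** This undoes the numbering [strand]: the index 0 stands for strand 3. *)
Definition lam4 (p : gen6) : VP4 :=
  let i := if p.2 == 0 :> nat then 3 else p.2 in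
  if p.1 then lam 4 i 4 else lam 4 4 i.

(** The model sends [lam4 p] to the translation by the letter [p], so following [free_lift lam4] by
    it gives the regular representation, which is faithful. *)
Lemma lam4_free : injective (free_lift lam4).
Proof.
have [h hE] := VP4_rec vp4_rels_model.
move=> u v /(congr1 h); rewrite !free_lift_comp.
have e : h \o lam4 =1 shift \o @letter gen6.
  by move=> [b [[|[|[|//]]] ?]]; case: b; rewrite /= hE //; congr shift;
    apply: reduce_eq; apply/eqP; vm_compute.
by rewrite !(eq_free_lift e) -!free_lift_comp !free_liftK => /shift_inj.
Qed.

(** * The presentations *)

Lemma gen_subgroup_conj (G : groupType) (S T : set G) (t : G) :
  (forall x, S x -> T (x ^ t)) ->
  forall x, gen_subgroup S x -> gen_subgroup T (x ^ t).
Proof.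
move=> ST; apply: gen_subgroup_min => [|x Sx]; last exact: sub_gen_subgroup (ST _ Sx).
have sT := @gen_subgroup_subgroup _ T; apply/subgroupP; split=> [|x y Tx Ty].
  by rewrite conj1g; apply: subgroup1.
by rewrite conjMg conjVg; apply: (subgroupM sT) => //; apply: (subgroupV sT).
Qed.

Lemma free_lift_conj (X : choiceType) (H : groupType) (f : X -> H) (t : H) u :
  free_lift (fun x => f x ^ t) u = free_lift f u ^ t.
Proof.
rewrite /free_lift; elim: (free_repr u) => [|[x b] s IHs] /=; first by rewrite conj1g.
by rewrite conjMg IHs; case: b; rewrite //= conjVg.
Qed.

(** The position of [lam4 p] in the list l34, l24, l14, l43, l42, l41 of [A_words_lam]. *)
Definition lam4_index (p : gen6) : nat := (if p.1 then 0 else 3) + (3 - p.2) %% 3.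

Lemma A_words_lam4 p : free_lift g4_val A_words`_(lam4_index p) = lam4 p.
Proof.
have := A_words_lam (lam 4); rewrite -(funext g4_val_word) => -[].
by case: p => -[] [[|[|[|//]]] ?].
Qed.

Lemma B_words_lam4 p :
  free_lift g4_val B_words`_(lam4_index p) = lam4 p ^ Elements.a11.
Proof.
have := A_gens_conj; rewrite -A_words_val -B_words_val => -[e1 e2 e3 e4 e5 e6].
by rewrite -A_words_lam4; case: p => -[] [[|[|[|//]]] ?].
Qed.

Lemma G4_free_lift : range (free_lift g4_val) = G4.
Proof. exact: range_free_lift. Qed.

Lemma g4_presents : presents g4_rel G4 g4_val.
Proof.
apply: presentsI G4_free_lift g4_val_respects _ => u u1.
have [psi psiE] := pres_rec g4_val_respects.
pose al p := pres_pi g4_rel A_words`_(lam4_index p).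
pose be p := pres_pi g4_rel B_words`_(lam4_index p).
(* Freeness is pulled back along [psi] from VP_4, where the first words become the l_i4 and l_4i,
   and the second ones their conjugates by [a11]. *)
have al_inj : injective (free_lift al).
  apply: (@inj_compr _ _ _ psi) => v w /=; rewrite !free_lift_comp.
  have e : psi \o al =1 lam4 by move=> p; rewrite /= psiE A_words_lam4.
  by rewrite !(eq_free_lift e) => /lam4_free.
have be_inj : injective (free_lift be).
  apply: (@inj_compr _ _ _ psi) => v w /=; rewrite !free_lift_comp.
  have e : psi \o be =1 fun p => lam4 p ^ Elements.a11.
    by move=> p; rewrite /= psiE B_words_lam4.
  by rewrite !(eq_free_lift e) !free_lift_conj => /conjg_inj/lam4_free.
(* The faithful [rho] and [t] induce a representation of VP_4. As [u] is trivial in VP_4, it acts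
   trivially there, hence is trivial in the presented group. *)
have [S [rho [t [rho_inj rhot]]]] := hnn_action al_inj be_inj.
pose f := rho \o @pres_gen _ g4_rel.
have fE v : free_lift f v = rho (pres_pi g4_rel v).
  by rewrite -free_lift_comp pres_lift.
have [||h [_ hE]] := @VP4_hnn_rec _ f t.
- by move=> v w vw; rewrite !fE -!pres_lift (respects_pres_gen vw).
- have e p : free_lift f A_words`_(lam4_index p) ^ t = free_lift f B_words`_(lam4_index p).
    rewrite !fE -/(al p) -/(be p) -(free_lift_letter al) -(free_lift_letter be).
    exact: rhot.
  have e1 := e (true, strand 3); have e2 := e (true, strand 2).
  have e3 := e (true, strand 1); have e4 := e (false, strand 3).
  have e5 := e (false, strand 2); have e6 := e (false, strand 1).
  rewrite /map; congr [:: _; _; _; _; _; _];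
    [exact: e1|exact: e2|exact: e3|exact: e4|exact: e5|exact: e6].
apply: rho_inj; rewrite -fE gmulf1 -(eq_free_lift hE) -free_lift_comp u1; exact: gmulf1.
Qed.

(** The formulas of [hnn_lam] hold in VP_4, which is therefore generated by G_4 and [a11]. *)
Lemma lam_hnn i j : strands 4 [:: i; j] ->
  lam 4 i j = hnn_lam g4_val Elements.a11 i j.
Proof.
have [e1 e2 e3 e4 e5 e6] := A_words_lam (lam 4).
rewrite -(funext g4_val_word) in e1 e2 e3 e4 e5 e6.
case: i j => [|[|[|[|[|?]]]]] [|[|[|[|[|?]]]]] s.
all: try by move: s; rewrite /strands /= ?andbF.
all: rewrite /hnn_lam ?e1 ?e2 ?e3 ?e4 ?e5 ?e6 //.
all: by rewrite !g4_val_word /= /Elements.a11 !gnorm.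
Qed.

Lemma VP4_generated (K : set VP4) :
  subgroup K -> G4 `<=` K -> K Elements.a11 -> K = setT.
Proof.
move=> sK GK Ka; apply/seteqP; split=> // v _.
have Kg g : K (g4_val g) by apply: GK; apply: sub_gen_subgroup; exists g.
have Kw w : K (free_lift g4_val w) by apply: GK; rewrite -G4_free_lift; exists w.
have Klam i j : strands 4 [:: i; j] -> K (lam 4 i j).
  move=> ij; rewrite lam_hnn // /hnn_lam; have K1 := subgroup1 sK.
  by case: i j {ij} => [|[|[|[|[|?]]]]] [|[|[|[|[|?]]]]];
    do ?[exact: Kg|exact: Kw|apply: (subgroupM sK)|apply: (subgroupV sK)].
suff : gen_subgroup (range (@pres_gen _ (@VP_rel 4))) `<=` K.
  apply; rewrite -range_free_lift; exists (pres_repr v) => //.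
  by rewrite pres_lift pres_reprK.
apply: gen_subgroup_min => // _ [p _ <-].
have -> : pres_gen (@VP_rel 4) p = lam 4 (val p).1 (val p).2.
  by rewrite /lam /free_lam -surjective_pairing valK free_lift_letter.
apply: Klam; rewrite /strands /= inE !andbT.
by case: p => -[i j] /= /and3P[-> -> ->].
Qed.

(** * The presentation of VP_4 by its base group and stable letter *)

Section HNNPresentation.

Let a11 := Elements.a11.
Let phi (x : VP4) := a11^-1 * x * a11.
Let R := hnn_rel (G := G4) Elements.A phi.
Let P := presented_group R.
Let iota (x : G4) : P := pres_gen R (Some x).

Lemma phiE x : phi x = x ^ a11. Proof. by rewrite /phi -mulgA. Qed.

Lemma iota_mul x y z : val x * val y = val z -> iota x * iota y = iota z.
Proof.
by move/(@hnn_table _ _ Elements.A phi)/respects_pres_gen; rewrite !free_liftE.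
Qed.

Lemma iota_conj x y : Elements.A (val x) -> phi (val x) = val y ->
  iota x ^ pres_gen R None = iota y.
Proof.
by move=> Ax /(hnn_stable Ax)/respects_pres_gen; rewrite !free_liftE.
Qed.

Lemma G4_val w : free_lift g4_val w \in G4.
Proof. by rewrite -G4_free_lift; apply/mem_set; exists w. Qed.

Let elt w : G4 := SigSub (G4_val w).

Let f g : P := iota (elt (letter g)).

Lemma free_lift_iota w : free_lift f w = iota (elt w).
Proof.
have M v w' : iota (elt (v * w')) = iota (elt v) * iota (elt w').
  by apply/esym/iota_mul; rewrite /= free_liftM.
have iota1 : iota (elt 1) = 1 by apply: (mulgI (iota (elt 1))); rewrite -M !mulg1.
have IM : monoid_morphism (fun w => iota (elt w)) by split.
pose m := isUMagmaMorphism.Build _ _ (fun w => iota (elt w)) IM.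
pose h := HB.pack_for (UMagmaMorphism.type (free_group g4_gen) P) (fun w => iota (elt w)) m.
by rewrite -[RHS]/(h w) -{2}[w]free_liftK free_lift_comp.
Qed.

Lemma base_respects : respects g4_rel f.
Proof.
move=> v w vw; rewrite !free_lift_iota; congr iota; apply: val_inj.
exact: g4_val_respects vw.
Qed.

(** [VP4_hnn_rec] gives a morphism from VP_4 to [P] sending the value of each letter back to that
    letter, so a word trivial in VP_4 is trivial in [P]. *)
Lemma hnn_presents_VP4 : presents R setT (hnn_val a11).
Proof.
apply: presentsI.
- rewrite range_free_lift; apply: VP4_generated.
  + exact: gen_subgroup_subgroup.
  + by move=> x Gx; apply: sub_gen_subgroup; exists (Some (SigSub (mem_set Gx))).
  + by apply: sub_gen_subgroup; exists None.
- move=> _ _ [x y z xyz|x y Ax xy]; rewrite !free_liftE //.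
  by rewrite /= -phiE.
have [|h [h11 hE]] := VP4_hnn_rec base_respects (t := pres_gen R None).
  have e k : (k < 6)%N -> free_lift f A_words`_k ^ pres_gen R None = free_lift f B_words`_k.
    move=> k6; rewrite !free_lift_iota; apply: iota_conj => /=.
      apply: sub_gen_subgroup; rewrite /= -(nth_map 1 1 (free_lift g4_val)) //.
      by rewrite A_words_val mem_nth.
    rewrite phiE -!(nth_map 1 1 (free_lift g4_val)) // A_words_val B_words_val.
    by rewrite -A_gens_conj (nth_map 1).
  apply: (@eq_from_nth _ 1); first by rewrite !size_map.
  by move=> k; rewrite size_map => k6; rewrite !(nth_map 1) //; apply: e.
move=> u u1; have hv : h \o hnn_val a11 =1 @pres_gen _ R.
  move=> [x|] //=.
  (* The letters include all elements of G_4, whereas [h] is known on the eleven generators; hence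
     [x] is written as a word in these. *)
  have [w _ wx] : range (free_lift g4_val) (val x).
    by rewrite G4_free_lift; apply: set_mem (valP x).
  rewrite -wx free_lift_comp (eq_free_lift hE) free_lift_iota.
  by congr (pres_gen R (Some _)); apply: val_inj.
by rewrite -pres_lift -(eq_free_lift hv) -free_lift_comp u1 gmulf1.
Qed.

End HNNPresentation.

Theorem theorem5p12 :
  [/\ HNN_extension G4 Elements.A Elements.B
        (fun x : VP4 => (Elements.a11^-1 * x * Elements.a11)%g) Elements.a11,
      [seq (Elements.a11^-1 * x * Elements.a11)%g | x <- Elements.A_gens]
        = Elements.B_gens
    & presents g4_rel G4 g4_val].
Proof.
have conjE x : (Elements.a11^-1 * x * Elements.a11)%g = x ^ Elements.a11 by rewrite -mulgA.
have gens : [seq (Elements.a11^-1 * x * Elements.a11)%g | x <- Elements.A_gens]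
    = Elements.B_gens.
  by rewrite -A_gens_conj; apply: eq_map => x.
split; [|exact: gens|exact: g4_presents].
have sG := @gen_subgroup_subgroup _ (range g4_val).
have sA := @gen_subgroup_subgroup _ [set` Elements.A_gens].
have sB := @gen_subgroup_subgroup _ [set` Elements.B_gens].
have wordsG ws : [set` map (free_lift g4_val) ws] `<=` G4.
  by move=> x /mapP[w _ ->]; rewrite -G4_free_lift; exists w.
split; [exact: sG|exact: sA|exact: sB| | | | |].
- by apply: gen_subgroup_min => //; rewrite -A_words_val; apply: wordsG.
- by apply: gen_subgroup_min => //; rewrite -B_words_val; apply: wordsG.
- by move=> x y _ _; rewrite !conjE conjMg.
- split.
  + move=> x Ax; rewrite conjE; apply: gen_subgroup_conj Ax => y Ay /=.
    by rewrite -A_gens_conj; apply: (map_f (fun z => z ^ Elements.a11)).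
  + by move=> x y _ _; rewrite !conjE => /conjg_inj.
  + move=> y By; exists (y ^ Elements.a11^-1); last by rewrite conjE conjgKV.
    apply: gen_subgroup_conj By => z /=.
    by rewrite -A_gens_conj => /mapP[x Ax ->]; rewrite conjgK.
- exact: hnn_presents_VP4.
Qed.
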